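(* Let $q\in(0,1)$, and let $S^r_n$, $(n,r)\in\mathbb{Z}^2$, be i.i.d. random variables with distribution $\mathrm{Ber}(q)\mathrm{Exp}(1)$. For $x>0$ let $f(x)$ be the time constant of the directed first-passage percolation model with these weights, i.e. the almost sure limit $$f(x)=\lim_{N\to\infty}\frac1N F\big((0,0),(\lfloor xN\rfloor,N)\big),$$ where $F$ is the first-passage time defined in the context. Then for every $x>0$ $$f(x)=\sup_{0<r<1}r^2\left[\frac{qx}{1-q+rq}-\frac{1}{1-r}\right].$$
   Context: A random variable $S$ has distribution $\mathrm{Ber}(q)\mathrm{Exp}(1)$ if it is the product of two independent random variables, one Bernoulli with parameter $q$ and the other exponential with rate $1$; that is, $S\ge0$ and $\mathbb{P}(S\ge s)=qe^{-s}$ for $s>0$. For $(i,j)\le(k,l)$ in $\mathbb{Z}^2$ (coordinatewise), $\Pi((i,j),(k,l))$ is the set of directed paths $(i,r_1),(i+1,r_2),\dots,(k,r_{k-i+1})$ with integers $j\le r_1\le r_2\le\dots\le r_{k-i+1}\le l$ (strictly increasing, by unit steps, in the first coordinate and weakly increasing in the second). The weight of a path $\gamma$ is $S(\gamma)=\sum_{(n,r)\in\gamma}S^r_n$, and the first-passage time is $$F\big((i,j),(k,l)\big)=\min_{\gamma\in\Pi((i,j),(k,l))}S(\gamma).$$ The almost sure limit defining $f(x)$ exists and is constant by Kingman's subadditive ergodic theorem. *)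

(* Defs.v *)
From HB Require Import structures.
From mathcomp Require Import all_boot all_order all_algebra.
From mathcomp Require Import finmap.
From mathcomp Require Import all_classical all_reals all_analysis.

Set Implicit Arguments.
Unset Strict Implicit.
Unset Printing Implicit Defensive.

Import Order.TTheory GRing.Theory Num.Theory.
Import numFieldNormedType.Exports.

Local Open Scope classical_set_scope.
Local Open Scope ring_scope.

(* Mutual independence of a possibly infinite family: the product rule for
   every finite subfamily and every choice of Borel sets. *)
Definition mutually_independent (R : realType) (d : measure_display)
    (T : measurableType d) (P : probability T R) (I : choiceType)
    (X : I -> {RV P >-> R}) : Prop :=
  forall (J : {fset I}) (A : I -> set R), (forall i, measurable (A i)) ->
    P (\bigcap_(i in [set` J]) (X i @^-1` A i)) =
    (\prod_(i <- J) P (X i @^-1` A i))%E.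

(* The law Ber(q)Exp(1): the image under [(b, e) |-> b * e] of the product of
   the Bernoulli(q) law (on [bool]) and the exponential law of rate 1. *)
Definition ber_exp_law (R : realType) (q : R) (A : set R) : \bar R :=
  (bernoulli_prob q \x exponential_prob 1)%E
    [set be : bool * R | A ((be.1)%:R * be.2)].

Definition has_ber_exp_law (R : realType) (d : measure_display)
    (T : measurableType d) (P : probability T R) (q : R)
    (X : {RV P >-> R}) : Prop :=
  forall A : set R, measurable A -> distribution P X A = ber_exp_law q A.

(* A path is the sequence of its sites: the first coordinates are
   i, i+1, ..., k, the second ones are nondecreasing and lie in [j, l].
   Meaningful only when u <= v coordinatewise. *)
Definition directed_paths (u v : int * int) : set (seq (int * int)) :=
  [set g | [/\ unzip1 g = [seq u.1 + n%:Z | n <- iota 0 (`|v.1 - u.1|%N).+1],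
               sorted <=%R (unzip2 g)
             & all (fun r => u.2 <= r <= v.2) (unzip2 g)]].

Definition path_weight (R : realType) (s : int * int -> R)
    (g : seq (int * int)) : R := \sum_(p <- g) s p.

(* For u <= v there are finitely many paths, at least one, so that this
   infimum is a minimum (see [passage_timeP]). *)
Definition passage_time (R : realType) (s : int * int -> R)
    (u v : int * int) : R :=
  inf [set path_weight s g | g in directed_paths u v].

Definition is_time_constant (R : realType) (d : measure_display)
    (T : measurableType d) (P : probability T R)
    (S : int * int -> {RV P >-> R}) (x c : R) : Prop :=
  {ae P, forall w : T,
    (fun N : nat =>
       passage_time (fun p => S p w) (0, 0) (Num.floor (x * N%:R), N%:Z) / N%:R)
    @ \oo --> c}.

Lemma directed_paths_finite u v : finite_set (directed_paths u v).
Proof.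
set m := (`|v.1 - u.1|%N).+1; set n := (`|v.2 - u.2|%N).+1.
pose c := [seq u.1 + i%:Z | i <- iota 0 m].
pose D := [set t : m.-tuple 'I_n | True].
pose h (t : m.-tuple 'I_n) :=
  zip c [seq u.2 + (nat_of_ord i)%:Z | i <- t].
apply: (@sub_finite_set _ _ (h @` D)); last first.
  exact/finite_image/finite_finset.
move=> g [g1 _ /allP g2].
have sg : size g = m by rewrite -(size_map fst) -/(unzip1 g) g1 size_map size_iota.
pose t := [seq (inord `|r - u.2|%N : 'I_n) | r <- unzip2 g].
have st : size t == m by rewrite !size_map sg.
exists (Tuple st) => //=.
rewrite /h /= -[RHS](zip_unzip g) g1 /t -/c; congr zip.
rewrite -map_comp -[RHS]map_id; apply/eq_in_map => r /g2 /andP[ur rv] /=.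
have ur0 : 0 <= r - u.2 by rewrite subr_ge0.
have rn : (`|r - u.2| < n)%N.
  rewrite /n ltnS -lez_nat !gez0_abs ?lerD2r //.
  by rewrite subr_ge0; apply: le_trans rv.
by rewrite inordK // gez0_abs // subrKC.
Qed.

Lemma directed_paths_neq0 u v : u.2 <= v.2 -> directed_paths u v !=set0.
Proof.
move=> uv; set c := [seq u.1 + i%:Z | i <- iota 0 (`|v.1 - u.1|%N).+1].
exists [seq (a, u.2) | a <- c].
have u2E : unzip2 [seq (a, u.2) | a <- c] = nseq (size c) u.2.
  by elim: (c) => // a l /= ->.
split; rewrite ?u2E.
- by rewrite /unzip1 -map_comp map_id.
- by case: (size c) => // k /=; elim: k => //= k ->; rewrite lexx.
- by elim: (size c) => //= k ->; rewrite lexx uv.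
Qed.

Lemma passage_timeP (R : realType) (s : int * int -> R) u v : u.2 <= v.2 ->
  (exists2 g, directed_paths u v g & passage_time s u v = path_weight s g) /\
  (forall g, directed_paths u v g -> passage_time s u v <= path_weight s g).
Proof.
move=> uv; set W := [set path_weight s g | g in directed_paths u v].
have Wfin : finite_set W by exact/finite_image/directed_paths_finite.
have [g0 g0P] := directed_paths_neq0 uv.
suff [g gP gle] : exists2 g, directed_paths u v g &
    forall g', directed_paths u v g' -> path_weight s g <= path_weight s g'.
  have gE : passage_time s u v = path_weight s g.
    apply/eqP; rewrite eq_le; apply/andP; split.
      apply: ge_inf; last by exists g.
      by exists (path_weight s g) => _ [g' g'P <-]; exact: gle.
    apply: lb_le_inf; first by exists (path_weight s g); exists g.
    by move=> _ [g' g'P <-]; exact: gle.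
  by split; [exists g | move=> g' g'P; rewrite gE; exact: gle].
have [l lE] : exists l : seq _, directed_paths u v = [set` l].
  exact/finite_seqP/directed_paths_finite.
have: g0 \in l by move: g0P; rewrite lE.
rewrite {}lE {g0P W Wfin} => g0l.
suff [g gl gle] : exists2 g, g \in l &
    forall g', g' \in l -> path_weight s g <= path_weight s g'.
  by exists g.
elim: l g0 g0l => // a l IH g0 _.
case: l IH => [_|b l IH].
  by exists a; rewrite ?mem_head // => g'; rewrite inE => /eqP ->.
have [g gl gle] := IH b (mem_head _ _).
have [ag|ga] := leP (path_weight s a) (path_weight s g).
  exists a; first exact: mem_head.
  by move=> g'; rewrite inE => /predU1P[-> //|/gle]; exact: le_trans.
exists g; first by rewrite inE gl orbT.
by move=> g'; rewrite inE => /predU1P[->|/gle //]; exact: ltW.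
Qed.

Lemma is_time_constant_unique (R : realType) (d : measure_display)
    (T : measurableType d) (P : probability T R)
    (S : int * int -> {RV P >-> R}) (x c1 c2 : R) :
  is_time_constant S x c1 -> is_time_constant S x c2 -> c1 = c2.
Proof.
move=> h1 h2; have [w [w1 w2]] : exists w : T,
    (fun N : nat => passage_time (fun p => S p w) (0, 0)
      (Num.floor (x * N%:R), N%:Z) / N%:R) @ \oo --> c1 /\
    (fun N : nat => passage_time (fun p => S p w) (0, 0)
      (Num.floor (x * N%:R), N%:Z) / N%:R) @ \oo --> c2.
  have ae_proper : ProperFilter (almost_everywhere P).
    apply: ae_properfilter_algebraOfSetsType.
    have PT : P setT = 1%E by exact: probability_setT.
    by apply: lt_le_trans (@lte01 R) _; rewrite -PT.
  exact: filter_ex (filterI h1 h2).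
exact: cvg_unique w1 w2.
Qed.

Lemma time_constant_formula_has_sup (R : realType) (q x : R) :
  0 < q < 1 -> 0 < x ->
  has_sup [set r ^+ 2 * (q * x / (1 - q + r * q) - 1 / (1 - r))
            | r in `]0, 1[%classic].
Proof.
move=> /andP[q0 q1] x0; split.
  exists (2^-1 ^+ 2 * (q * x / (1 - q + 2^-1 * q) - 1 / (1 - 2^-1))).
  exists 2^-1 => //=; rewrite in_itv /= invr_gt0 ltr0n /=.
  by rewrite invf_lt1 // ltr1n.
exists (q * x / (1 - q)) => y [r /=]; rewrite in_itv /= => /andP[r0 r1] <-.
have p0 : 0 < 1 - q by rewrite subr_gt0.
have h0 : 0 <= q * x / (1 - q) by rewrite !mulr_ge0 ?invr_ge0 // ltW.
have h1 : q * x / (1 - q + r * q) - 1 / (1 - r) <= q * x / (1 - q).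
  rewrite lerBlDr; apply: ler_wpDr.
    by rewrite divr_ge0 // subr_ge0 ltW.
  have rq : 0 < r * q by rewrite mulr_gt0.
  apply: ler_wpM2l; first by rewrite mulr_ge0 ?ltW.
  have b0 : 0 < 1 - q + r * q by exact: addr_gt0.
  by rewrite lef_pV2 // lerDl ltW.
apply: (@le_trans _ _ (r ^+ 2 * (q * x / (1 - q)))).
  by rewrite ler_wpM2l // exprn_ge0 // ltW.
by rewrite ler_piMl // exprn_ile1 // ltW.
Qed.

Lemma ber_exp_law_tail (R : realType) (q s : R) : 0 < q < 1 -> 0 < s ->
  ber_exp_law q `[s, +oo[%classic = (q * expR (- s))%:E.
Proof.
move=> /andP[q0 q1] s0; have q01 : 0 <= q <= 1 by rewrite !ltW.
have exp_ge0 A : (0 <= exponential_prob (1 : R) A)%E.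
  by apply: integral_ge0 => y _; rewrite lee_fin exponential_pdf_ge0.
have cE : continuous (fun z : R^o => expR (- 1 * z)).
  move=> z; apply: continuous_comp; last exact: continuous_expR.
  by apply: continuousM => //; exact: cst_continuous.
have tail : exponential_prob 1 `[s, +oo[%classic = (expR (- s))%:E.
  rewrite /exponential_prob.
  rewrite (@ge0_continuous_FTC2y _ _ (fun x => - expR (- 1 * x)) s 0).
  - by rewrite EFinN oppeK add0e mulN1r.
  - by move=> y _; exact: exponential_pdf_ge0.
  - apply: (@continuous_subspaceW R^o _ _ [set` `[0, +oo[%R]).
      by apply: subset_itvr; rewrite bnd_simp ltW.
    exact: within_continuous_exponential_pdf.
  - rewrite -oppr0; apply: cvgN.
    rewrite (_ : (fun x => expR (- 1 * x)) = (fun z => expR (- z))); last first.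
      by apply: eq_fun => x; rewrite mulN1r.
    exact: cvgr_expR.
  - by move=> y _; exact: ex_derive.
  - by apply: cvgN; apply/cvg_at_right_filter; exact: cE.
  - move=> z; rewrite in_itv/= andbT => sz.
    by apply: derive1_exponential_pdf; rewrite in_itv/= andbT (lt_trans s0).
rewrite /ber_exp_law /product_measure1 (integral_bernoulli_prob q01) /=; last first.
  by move=> b; exact: exp_ge0.
set A := xsection _ true; set B := xsection _ false.
have -> : A = `[s, +oo[%classic.
  by apply/seteqP; split=> y; rewrite /A /xsection /= inE /= mul1r.
have -> : B = set0.
  apply/seteqP; split=> y //; rewrite /B /xsection /= inE /= mul0r in_itv /=.
  by rewrite andbT leNgt s0.
by rewrite tail [X in (_ + _ * X)%E]/exponential_prob integral_set0 mule0 adde0.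
Qed.

(* Main.v *)
Require Import Defs.
From HB Require Import structures.
From mathcomp Require Import all_boot all_order all_algebra.
From mathcomp Require Import finmap.
From mathcomp Require Import all_classical all_reals all_analysis measurable_realfun.
From mathcomp Require Import ring lra.

Set Implicit Arguments.
Unset Strict Implicit.
Unset Printing Implicit Defensive.

Import Order.TTheory GRing.Theory Num.Theory.
Import numFieldNormedType.Exports.

Local Open Scope classical_set_scope.
Local Open Scope ring_scope.

(** Write [F] as the solution of [F(k,l) = min (F(k,l-1), F(k-1,l) + S(k,l))] and
    compare it with the solution [G] of the same recursion started from
    independent random increments on the two axes: [Ber(q/(1+(1-q)g))Exp(1+g)]
    on the horizontal one, [-Ber(1/(1+g))Exp(g)] on the vertical one.  This law is
    preserved by the recursion (Burke property): with [W], [A], [S] the three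
    inputs at a vertex, [X = W + A] is [Ber(1/(1+(1-q)g))Exp(g)], and
    [(min(X,S), (X-S)^+)] has the law of [(W,A)].  Hence on each row [G] has
    i.i.d. increments, and [G/N] tends to [h_r(x) = x a(r) - b(r)], where
    [r = 1/(1+g)], [a(r) = q r^2/(1-q+rq)] and [b(r) = r^2/(1-r)].

    Since [G <= F], [F/N] is asymptotically at least [sup_r h_r(x)].  Conversely,
    take [r] maximizing [h_r(x)] and look at the boundary point where the optimal
    path of [G_r] enters the bulk.  Following that path from that point in the
    process [G_s] gives, for [s] slightly above (below) [r], a contradiction if
    the point is at distance of order [N] on the vertical (horizontal) axis,
    because [h] is flat at its maximum while [b] and [a] increase at positive
    rate.  So the path leaves the boundary after [o(N)] steps, and [F] exceeds
    [G_r] by at most [o(N)].  If the supremum is not attained, then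
    [qx <= 1 - q], it is 0, and monotonicity in [x] applies. *)

(** * Independent families and the operations that preserve independence *)

Section independence.
Context (R : realType) (d : measure_display) (T : measurableType d)
  (P : probability T R).

(** Rays form a pi-system generating the Borel sets, and those starting at [- n] exhaust the line.
    Laws are identified from their tails in this way below. *)
Lemma eq_measure_rays (m1 m2 : {measure set R -> \bar R}) :
  (m1 setT < +oo)%E ->
  (forall t, m1 `]t, +oo[%classic = m2 `]t, +oo[%classic) ->
  forall A : set R, measurable A -> m1 A = m2 A.
Proof.
move=> m1oo m12 A mA.
pose G := [set C : set R | exists x, C = `]x, +oo[%classic].
have GI : setI_closed G.
  move=> _ _ [x ->] [y ->]; exists (Num.max x y); apply/seteqP; split=> z /=;
  by rewrite !in_itv /= !andbT gt_max => /andP.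
apply: (measure_unique G (fun n => `](- n%:R), +oo[%classic)) => //.
- exact: measurable_realfun.RGenOInfty.measurableE.
- by move=> n; exists (- n%:R).
- apply/seteqP; split=> // z _.
  exists (Num.bound `|z|) => //=; rewrite in_itv /= andbT ltrNl.
  apply: le_lt_trans (archi_boundP (normr_ge0 z)).
  by rewrite -normrN ler_norm.
- by move=> _ [x ->]; exact: m12.
- by move=> k; apply: le_lt_trans m1oo; apply: le_measure; rewrite ?inE.
Qed.

(** Restricting [P] to [Q] and dividing by [P Q] gives a joint law that is a product on rectangles;
    uniqueness of product measures concludes. [Q] will be an event about the remaining variables of
    a family. *)
Lemma joint_distribution (X Y : {RV P >-> R}) (Q : set T) : measurable Q ->
  (forall B C, measurable B -> measurable C ->
    P (X @^-1` B `&` Y @^-1` C `&` Q) =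
    (P (X @^-1` B) * P (Y @^-1` C) * P Q)%E) ->
  forall E : set (R * R), measurable E ->
  P ([set w | E (X w, Y w)] `&` Q) =
  ((distribution P X \x distribution P Y) E * P Q)%E.
Proof.
move=> mQ h E mE.
have mXY : measurable_fun setT (fun w => (X w, Y w)).
  by apply/measurable_fun_pair.
have [Q0|Q0] := eqVneq (P Q) 0%E.
  rewrite Q0 mule0; apply/eqP; rewrite eq_le measure_ge0 andbT -Q0.
  apply: le_measure; rewrite ?inE//.
  by apply: measurableI => //; rewrite -[X in measurable X]setTI; exact: mXY.
have Qfin : P Q \is a fin_num by exact: fin_num_measure.
have c0 : 0 < fine (P Q).
  by rewrite fine_gt0// lt0e Q0 measure_ge0/= ltey_eq Qfin.
pose c : {nonneg R} := NngNum (ltW (etrans (invr_gt0 (fine (P Q))) c0)).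
pose m' := pushforward (mscale c (mrestr P mQ)) (fun w => (X w, Y w)).
have m'E F : m' F = ((fine (P Q))^-1%:E * P ([set w | F (X w, Y w)] `&` Q))%E.
  by [].
have -> : (distribution P X \x distribution P Y)%E E = m' E.
  apply: product_measure_unique => // B C mB mC.
  transitivity (m' (B `*` C)) => //.
  rewrite m'E.
  have -> : P ([set w | (B `*` C) (X w, Y w)] `&` Q) = _ := h B C mB mC.
  by rewrite muleCA -[X in (_ * (_ * X))%E](fineK Qfin) -EFinM mulVf ?gt_eqF// mule1.
by rewrite m'E -[X in (_ * _ * X)%E](fineK Qfin) muleAC -EFinM mulVf ?gt_eqF// mul1e.
Qed.

(** Duplicate-free lists and plain functions replace finite sets and bundled random variables, so
    that families can be reindexed and modified entry by entry. *)
Definition independent_family (I : eqType) (X : I -> T -> R) :=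
  (forall i, measurable_fun setT (X i)) /\
  forall (s : seq I) (A : I -> set R), uniq s -> (forall i, measurable (A i)) ->
    P (\big[setI/setT]_(i <- s) (X i @^-1` A i)) =
    (\prod_(i <- s) P (X i @^-1` A i))%E.

Definition independent_pair (X Y : T -> R) :=
  [/\ measurable_fun setT X, measurable_fun setT Y &
  forall B C, measurable B -> measurable C ->
    P (X @^-1` B `&` Y @^-1` C) = (P (X @^-1` B) * P (Y @^-1` C))%E].

Lemma measurable_fun_preimage (X : T -> R) (A : set R) :
  measurable_fun setT X -> measurable A -> measurable (X @^-1` A).
Proof. by move=> mX mA; rewrite -[X in measurable X]setTI; exact: mX. Qed.

Lemma measurable_preimages (I : eqType) (X : I -> T -> R) (A : I -> set R)
    (s : seq I) (p : pred I) :
  (forall i, measurable_fun setT (X i)) -> (forall i, measurable (A i)) ->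
  measurable (\big[setI/setT]_(i <- s | p i) (X i @^-1` A i)).
Proof.
move=> mX mA; elim/big_ind: _ => // [B C|i _]; first exact: measurableI.
exact: measurable_fun_preimage.
Qed.

Lemma independent_family_eq (I : eqType) (X Y : I -> T -> R) :
  (forall i, X i = Y i) -> independent_family X -> independent_family Y.
Proof. by move=> /funext ->. Qed.

Lemma independent_family_can (I J : eqType) (f : J -> I) (g : I -> J)
  (X : I -> T -> R) :
  cancel f g -> independent_family X -> independent_family (X \o f).
Proof.
move=> fK [mX iX]; split=> [j|s A us mA]; first exact: mX.
have := iX [seq f j | j <- s] (A \o g).
rewrite map_inj_uniq; last exact: can_inj fK.
rewrite !big_map => /(_ us (fun i => mA (g i))).
rewrite (eq_bigr (fun j => (X \o f) j @^-1` A j)); last first.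
  by move=> j _ /=; rewrite fK.
by move=> ->; apply: eq_bigr => j _; rewrite /= fK.
Qed.

Lemma independent_family_comp (I : eqType) (X : I -> T -> R) (f : I -> R -> R) :
  (forall i, measurable_fun setT (f i)) -> independent_family X ->
  independent_family (fun i => f i \o X i).
Proof.
move=> mf [mX iX]; split=> [j|s A us mA]; first exact: measurableT_comp.
apply: (iX s (fun i => f i @^-1` A i)) => // i.
by rewrite -[X in measurable X]setTI; exact: mf.
Qed.

Lemma independent_family_pair (I : eqType) (X : I -> T -> R) (i j : I) :
  i != j -> independent_family X -> independent_pair (X i) (X j).
Proof.
move=> ij [mX iX]; split=> // B C mB mC.
have := iX [:: i; j] (fun k => if k == i then B else C).
rewrite !big_cons !big_nil eqxx eq_sym (negbTE ij) setIT mule1; apply.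
  by rewrite /= inE ij.
by move=> k; case: ifP.
Qed.

Lemma big_uniq_split (I : eqType) (V : Type) (idx : V) (op : Monoid.com_law idx)
    (s : seq I) (p : pred I) (F : I -> V) (i : I) : uniq s -> p i ->
  \big[op/idx]_(k <- s | p k) F k =
  op (if i \in s then F i else idx) (\big[op/idx]_(k <- s | p k && (k != i)) F k).
Proof.
move=> us pi; case: ifPn => iS.
  rewrite -big_filter (bigD1_seq i) ?mem_filter ?pi ?filter_uniq//=.
  by rewrite big_filter_cond.
rewrite Monoid.mul1m; rewrite big_seq_cond [RHS]big_seq_cond.
apply: eq_bigl => k; case: (boolP (k \in s)) => //= ks.
by rewrite (memPn iS) ?andbT.
Qed.

(** The engine of the later independence proofs: a pair of variables may be replaced by functions of
    that pair as soon as the new ones are independent of each other. The old pair is independent of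
    all other variables, so only the joint law of the new pair matters. *)
Lemma independent_family_update2 (I : eqType) (X X' : I -> T -> R) (i j : I)
    (g1 g2 : R * R -> R) :
  i != j ->
  measurable_fun setT g1 -> measurable_fun setT g2 ->
  X' i = (fun w => g1 (X i w, X j w)) -> X' j = (fun w => g2 (X i w, X j w)) ->
  (forall k, k != i -> k != j -> X' k = X k) ->
  independent_pair (X' i) (X' j) ->
  independent_family X -> independent_family X'.
Proof.
move=> ij mg1 mg2 X'i X'j X'k [mX'i mX'j indij] [mX iX]; split=> [k|s A us mA].
  by have [->//|ki] := eqVneq k i; have [->//|kj] := eqVneq k j; rewrite X'k.
pose p k := (k != i) && (k != j).
pose Q := \big[setI/setT]_(k <- s | p k) (X k @^-1` A k).
have mQ : measurable Q by exact: measurable_preimages.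
pose Ai := if i \in s then A i else setT.
pose Aj := if j \in s then A j else setT.
have mAi : measurable Ai by rewrite /Ai; case: ifP.
have mAj : measurable Aj by rewrite /Aj; case: ifP.
(* Entries [i] and [j] are split off, for intersections of events and for products of probabilities
   at once. *)
have bigX' (V : Type) (idx : V) (op : Monoid.com_law idx) (F : (T -> R) -> set R -> V) :
  (forall Z, F Z setT = idx) ->
  \big[op/idx]_(k <- s) F (X' k) (A k) =
  op (F (X' i) Ai) (op (F (X' j) Aj) (\big[op/idx]_(k <- s | p k) F (X k) (A k))).
  move=> FT; rewrite (big_uniq_split _ _ (i := i))//.
  rewrite (big_uniq_split _ _ (i := j))//=; last by rewrite eq_sym.
  congr (op _ (op _ _)).
  - by rewrite /Ai; case: ifP.
  - by rewrite /Aj; case: ifP.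
  - by apply: eq_bigr => k /andP[ki kj]; rewrite X'k.
have -> : \big[setI/setT]_(k <- s) (X' k @^-1` A k) =
    X' i @^-1` Ai `&` X' j @^-1` Aj `&` Q.
  rewrite -setIA; apply: (bigX' _ _ _ (fun Z B => Z @^-1` B)).
  by move=> Z; rewrite preimage_setT.
have -> : (\prod_(k <- s) P (X' k @^-1` A k) =
    P (X' i @^-1` Ai) * (P (X' j @^-1` Aj) *
    \prod_(k <- s | p k) P (X k @^-1` A k)))%E.
  apply: (bigX' _ _ _ (fun Z B => P (Z @^-1` B))).
  by move=> Z; rewrite preimage_setT probability_setT.
have PQE : P Q = (\prod_(k <- s | p k) P (X k @^-1` A k))%E.
  by rewrite /Q -[in LHS]big_filter iX ?filter_uniq// big_filter.
have PQ (B C : set R) : measurable B -> measurable C ->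
    P (X i @^-1` B `&` X j @^-1` C `&` Q) =
    (P (X i @^-1` B) * P (X j @^-1` C) * P Q)%E.
  move=> mB mC.
  pose A' k := if k == i then B else if k == j then C else A k.
  pose s' := i :: j :: [seq k <- s | p k].
  have us' : uniq s'.
    rewrite /= inE negb_or ij !mem_filter /p !eqxx /= andbF /=.
    exact: filter_uniq.
  have mA' k : measurable (A' k) by rewrite /A'; do 2 case: ifP => // _.
  have A'k k : p k -> A' k = A k by move=> /andP[/negbTE ki /negbTE kj]; rewrite /A' ki kj.
  have A'i : A' i = B by rewrite /A' eqxx.
  have A'j : A' j = C by rewrite /A' eqxx eq_sym (negbTE ij).
  have := iX s' A' us' mA'; rewrite !big_cons !big_filter A'i A'j.
  rewrite (eq_bigr (fun k => X k @^-1` A k)); last by move=> k pk; rewrite -A'k.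
  rewrite -/Q setIA => ->; rewrite muleA; congr (_ * _)%E.
  by rewrite PQE; apply: eq_bigr => k pk; rewrite A'k.
rewrite -PQE muleA -indij// X'i X'j.
pose XI : {RV P >-> R} := HB.pack (X i) (isMeasurableFun.Build _ _ _ _ _ (mX i)).
pose XJ : {RV P >-> R} := HB.pack (X j) (isMeasurableFun.Build _ _ _ _ _ (mX j)).
pose E : set (R * R) := g1 @^-1` Ai `&` g2 @^-1` Aj.
have mE : measurable E.
  by apply: measurableI; rewrite -[X in measurable X]setTI; [exact: mg1|exact: mg2].
(* Applied with [Q] and then with the whole space: events about the new pair are independent of
   [Q]. *)
have H1 := @joint_distribution XI XJ Q mQ PQ E mE.
have H2 := @joint_distribution XI XJ setT measurableT _ E mE.
rewrite [LHS]H1; congr (_ * _)%E.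
rewrite -[LHS]mule1 -(probability_setT P) -H2 ?setIT// => B C mB mC.
rewrite setIT probability_setT mule1.
have [_ _] := independent_family_pair ij (conj mX iX); exact.
Qed.

(** Independence concerns finitely many indices at a time, and on those some [X n] already agrees
    with [Y]. *)
Lemma independent_family_lim (I : eqType) (X : nat -> I -> T -> R) (Y : I -> T -> R) :
  (forall n, independent_family (X n)) ->
  (forall i, exists n, forall m, (n <= m)%N -> X m i = Y i) ->
  independent_family Y.
Proof.
move=> iX XY.
have XYs (s : seq I) : exists n, forall i, i \in s -> X n i = Y i.
  suff [n nP] : exists n, forall m, (n <= m)%N -> forall i, i \in s -> X m i = Y i.
    by exists n => i; exact: nP.
  elim: s => [|i s [n nP]]; first by exists 0.
  have [n' n'P] := XY i; exists (maxn n n') => m.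
  rewrite geq_max => /andP[nm n'm] k; rewrite inE => /predU1P[->|ks].
    exact: n'P.
  exact: nP.
split=> [i|s A us mA].
  by have [n nP] := XY i; rewrite -(nP n)//; exact: (iX n).1.
have [n nP] := XYs s; have := (iX n).2 s A us mA.
rewrite !(@big_seq _ _ _ _ s) => H.
rewrite (eq_bigr (fun i => X n i @^-1` A i)); last by move=> i /nP ->.
by rewrite H; apply: eq_bigr => i /nP ->.
Qed.

End independence.

(** * Integration against a measure given by a density *)

Section density.
Context (R : realType) (d : measure_display) (X : measurableType d).
Local Open Scope ereal_scope.
Import HBNNSimple.

Lemma ge0_integral_density (mu nu : {measure set X -> \bar R}) (g : X -> R) :
  measurable_fun setT g -> (forall x, (0 <= g x)%R) ->
  (forall A, measurable A -> nu A = \int[mu]_(x in A) (g x)%:E) ->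
  forall f : X -> \bar R, measurable_fun setT f -> (forall x, 0 <= f x) ->
  \int[nu]_x f x = \int[mu]_x (f x * (g x)%:E).
Proof.
move=> mg g0 nuE f mf f0.
have mgE : measurable_fun setT (EFin \o g) by exact/measurable_EFinP.
have simple (h : {nnsfun X >-> R}) :
    \int[nu]_x (h x)%:E = \int[mu]_x ((h x)%:E * (g x)%:E).
  rewrite integralT_nnsfun sintegralE.
  transitivity (\int[mu]_x \sum_(r \in range h)
      ((r * \1_(h @^-1` [set r]) x)%:E * (g x)%:E)); last first.
    apply: eq_integral => x _.
    rewrite [in RHS]fimfunE -fsumEFin// ge0_mule_fsuml// => r.
    exact: nnfun_muleindic_ge0.
  rewrite ge0_integral_fsum//; last 2 first.
    - move=> r; apply: emeasurable_funM => //; apply/measurable_EFinP.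
      by apply: measurable_funM => //; exact/measurable_indic.
    - by move=> r x _; apply: mule_ge0; [exact: nnfun_muleindic_ge0|rewrite lee_fin].
  apply: eq_fsbigr => r; rewrite inE => -[y _ <-].
  rewrite nuE// integral_mkcond.
  under [RHS]eq_integral do rewrite EFinM -muleA.
  rewrite ge0_integralZl//; first last.
  - by rewrite lee_fin.
  - by move=> x _; rewrite mule_ge0// lee_fin.
  - apply: emeasurable_funM => //; apply/measurable_EFinP.
    exact/measurable_indic.
  congr (_ * _); apply: eq_integral => x _.
  by rewrite patchE indicE; case: (x \in _); rewrite ?mul1e ?mul0e.
pose f_ := nnsfun_approx measurableT mf.
transitivity (lim (\int[nu]_x (f_ n x)%:E @[n --> \oo])).
  rewrite -monotone_convergence//=.
  - apply: eq_integral => x _; apply/esym/cvg_lim => //=.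
    exact: cvg_nnsfun_approx.
  - by move=> n; exact/measurable_EFinP/measurable_funTS.
  - by move=> n ? _; rewrite lee_fin.
  - by move=> ? _ ? ? mn; rewrite lee_fin; exact/lefP/nd_nnsfun_approx.
under eq_fun do rewrite simple.
rewrite -monotone_convergence//=.
- apply: eq_integral => x _; apply/cvg_lim => //=.
  by apply: cvgeZr => //; exact: cvg_nnsfun_approx.
- by move=> n; apply: emeasurable_funM => //; exact/measurable_EFinP/measurable_funTS.
- by move=> n x _; rewrite mule_ge0// lee_fin.
- move=> x _ m n mn; rewrite lee_wpmul2r// ?lee_fin//.
  exact/lefP/nd_nnsfun_approx.
Qed.

End density.

(** * Tails and tilting of the exponential law *)

Section exponential.
Context (R : realType).
Local Notation mu := lebesgue_measure.

Lemma measurable_expRM (a : R) : measurable_fun setT (fun x : R => expR (a * x)).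
Proof. by apply: measurableT_comp => //; exact: measurable_funM. Qed.

Let measurable_EFin_exponential_pdf (l : R) (D : set R) :
  measurable_fun D (fun x => (exponential_pdf l x)%:E).
Proof.
by apply: measurable_funTS; apply/measurable_EFinP; exact: measurable_exponential_pdf.
Qed.

Lemma exponential_prob_itvoy (l t : R) : 0 < l -> 0 <= t ->
  exponential_prob l `]t, +oo[%classic = (expR (- l * t))%:E.
Proof.
move=> l0 t0; rewrite /exponential_prob.
have cE : continuous (fun z : R^o => expR (- l * z)).
  move=> z; apply: continuous_comp; last exact: continuous_expR.
  by apply: continuousM => //; exact: cst_continuous.
rewrite integral_itv_obnd_cbnd; last first.
  exact: measurable_EFin_exponential_pdf.
rewrite (@ge0_continuous_FTC2y _ _ (fun x => - expR (- l * x)) t 0).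
- by rewrite EFinN oppeK add0e.
- by move=> y _; apply: exponential_pdf_ge0; exact: ltW.
- apply: (@continuous_subspaceW R^o _ _ [set` `[0, +oo[%R]).
    by apply: subset_itvr; rewrite bnd_simp.
  exact: within_continuous_exponential_pdf.
- rewrite -oppr0; apply: cvgN.
  rewrite (_ : (fun x => expR (- l * x)) =
               (fun z => expR (- z)) \o (fun z => l * z)); last first.
    by apply: eq_fun => x; rewrite mulNr.
  apply: (@cvg_comp _ _ _ _ _ _ (pinfty_nbhs R)); last exact: cvgr_expR.
  exact: gt0_cvgMry.
- by move=> y _; exact: ex_derive.
- by apply: cvgN; apply/cvg_at_right_filter; exact: cE.
- move=> z; rewrite in_itv/= andbT => tz.
  by apply: derive1_exponential_pdf; rewrite in_itv/= andbT (le_lt_trans t0).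
Qed.

Lemma exponential_prob_itvoy_lt0 (l t : R) : 0 < l -> t < 0 ->
  exponential_prob l `]t, +oo[%classic = 1%E.
Proof.
move=> l0 t0; rewrite -[RHS](integral_exponential_pdf l0) /exponential_prob.
rewrite [LHS]integral_mkcond/=.
apply: eq_integral => x _; rewrite patchE; case: ifPn => // xt.
rewrite lt0_exponential_pdf//; apply: le_lt_trans t0.
by move: xt; rewrite notin_setE/= in_itv/= andbT => /negP; rewrite -leNgt.
Qed.

(** Multiplying the density of rate [l] by [expR (a * x)] gives [l / (l - a)] times the density of
    rate [l - a]. *)
Lemma integral_expR_exponential_prob (l a : R) (B : set R) :
  0 < l -> a < l -> measurable B ->
  (\int[exponential_prob l]_(x in B) (expR (a * x))%:E =
   (l / (l - a))%:E * exponential_prob (l - a) B)%E.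
Proof.
move=> l0 al mB.
have la0 : 0 < l - a by rewrite subr_gt0.
rewrite integral_mkcond.
rewrite (ge0_integral_density (mu := mu) (g := exponential_pdf l))//.
- rewrite /exponential_prob -ge0_integralZl//.
  + rewrite [RHS]integral_mkcond; apply: eq_integral => x _; rewrite !patchE.
    case: ifP => _; last by rewrite mul0e.
    rewrite -!EFinM; congr (_%:E).
    have [x0|x0] := ltP x 0; first by rewrite !lt0_exponential_pdf// !mulr0.
    rewrite !exponential_pdfE// mulrCA -expRD mulrA divfK ?gt_eqF//.
    by congr (_ * expR _); ring.
  + exact: measurable_EFin_exponential_pdf.
  + by move=> x _; rewrite lee_fin exponential_pdf_ge0// ltW.
  + by rewrite lee_fin divr_ge0// ltW.
- exact: measurable_exponential_pdf.
- by move=> x; rewrite exponential_pdf_ge0// ltW.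
- apply/(measurable_restrictT _ mB); apply: measurable_funTS.
  by apply/measurable_EFinP; exact: measurable_expRM.
- by move=> x; rewrite patchE; case: ifP => // _; rewrite lee_fin expR_ge0.
Qed.

End exponential.

Lemma measurable_idR (R : realType) :
  measurable_fun [set: measurableTypeR R] (fun x : measurableTypeR R => x : R).
Proof. by move=> _ A mA; rewrite setTI. Qed.

(* [exponential_prob] is a measure on [measurableTypeR R], whose display is not
   the one of [R]. *)
Lemma exponential_measure (R : realType) (l : R) : 0 < l ->
  exists2 e : {measure set R -> \bar R}, forall A, e A = exponential_prob l A &
  forall (B : set R) f, measurable B -> measurable_fun B f ->
    (forall x, B x -> 0 <= f x)%E ->
    (\int[e]_(x in B) f x = \int[exponential_prob l]_(x in B) f x)%E.
Proof.
move=> l0.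
unshelve refine (ex_intro2 _ _ (pushforward (exponential_prob l) (fun x : measurableTypeR R => x : R) : {measure set R -> \bar R}) _ _).

- exact: measurable_idR.
- exact: l0.
- by [].
- move=> B f mB mf f0 /=; rewrite ge0_integral_pushforward//.
  by move=> x; rewrite inE; exact: f0.
Qed.

(** * The laws [Ber(p)Exp(l)] and the Burke property at one vertex *)

Section ber_exp.
Context (R : realType) (d : measure_display) (T : measurableType d)
  (P : probability T R).

Lemma independent_pair_integral (X Y : T -> R) (E : set (R * R)) :
  independent_pair P X Y -> measurable E ->
  P [set w | E (X w, Y w)] =
  (\int[pushforward P X]_x P [set w | E (x, Y w)])%E.
Proof.
move=> [mX mY iXY] mE.
pose X' : {RV P >-> R} := HB.pack X (isMeasurableFun.Build _ _ _ _ _ mX).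
pose Y' : {RV P >-> R} := HB.pack Y (isMeasurableFun.Build _ _ _ _ _ mY).
have H (B C : set R) : measurable B -> measurable C ->
    P (X' @^-1` B `&` Y' @^-1` C `&` setT) =
    (P (X' @^-1` B) * P (Y' @^-1` C) * P setT)%E.
  by move=> mB mC; rewrite setIT probability_setT mule1; exact: iXY.
have := joint_distribution measurableT H mE.
rewrite setIT probability_setT mule1 => ->.
rewrite /product_measure1; apply: eq_integral => x _ /=.
by rewrite /distribution /pushforward /xsection; congr (P _); apply/seteqP; split=> w /=; rewrite inE.
Qed.

(** [p] is the probability of being positive, [l] the rate. Tails at [t >= 0] and nonnegativity
    determine the law, atom at 0 included. *)
Definition ber_exp_rv (p l : R) (X : T -> R) :=
  [/\ measurable_fun setT X, forall w, 0 <= X w &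
      forall t, 0 <= t -> P [set w | t < X w] = (p * expR (- l * t))%:E].

Definition ber_exp_param (p l : R) := 0 <= p <= 1 /\ 0 < l.

Lemma ber_exp_rv_lt0 (p l : R) X t : ber_exp_rv p l X -> t < 0 ->
  P [set w | t < X w] = 1%E.
Proof.
move=> [_ X0 _] t0; rewrite -(probability_setT P); congr (P _).
by apply/seteqP; split=> // w _ /=; exact: lt_le_trans (X0 w).
Qed.

(** The law is a mixture of the exponential law, with weight [p], and of a point mass at 0; the
    first part is tilted, the atom is unchanged. *)
Lemma integral_ber_exp_rv (p l a : R) X (B : set R) :
  ber_exp_param p l -> ber_exp_rv p l X -> a < l -> measurable B ->
  (\int[pushforward P X]_(x in B) (expR (a * x))%:E =
   (p * (l / (l - a)))%:E * exponential_prob (l - a) B +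
   (1 - p)%:E * \d_(0%R : R) B)%E.
Proof.
move=> [/andP[p0 p1] l0] [mX X0 tX] al mB.
pose X' : {RV P >-> R} := HB.pack X (isMeasurableFun.Build _ _ _ _ _ mX).
pose c : {nonneg R} := NngNum p0.
have q0 : 0 <= 1 - p by rewrite subr_ge0.
pose c' : {nonneg R} := NngNum q0.
have [e eE intE] := exponential_measure l0.
pose m1 : {measure set R -> \bar R} := mscale c e.
pose m2 : {measure set R -> \bar R} := mscale c' (\d_(0%R : R) : {measure set R -> \bar R}).
have law (A : set R) : measurable A -> distribution P X' A = measure_add m1 m2 A.
  move=> mA; apply: eq_measure_rays => //.
    by rewrite /= /distribution /pushforward preimage_setT probability_setT ltry.
  move=> t; rewrite /= /measure_add/= /msum !big_ord_recl big_ord0/= adde0.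
  rewrite /mscale/= /mscale /=.
  have -> : distribution P X' `]t, +oo[%classic = P [set w | t < X w].
    by congr (P _); apply/seteqP; split=> w /=; rewrite in_itv/= andbT.
  rewrite eE; have [t0|t0] := ltP t 0.
    rewrite (ber_exp_rv_lt0 (p := p) (l := l))//.
    rewrite exponential_prob_itvoy_lt0// diracE mem_set/= ?in_itv/= ?t0//.
    by rewrite !mule1 -EFinD subrKC.
  rewrite tX// exponential_prob_itvoy// diracE memNset/= ?in_itv/= ?andbT.
    by rewrite mule0 adde0.
  by apply/negP; rewrite -leNgt.
rewrite (eq_measure_integral (measure_add m1 m2)); last first.
  by move=> A mA _; exact: law.
have mexp : measurable_fun B (fun x : R => (expR (a * x))%:E).
  by apply: measurable_funTS; apply/measurable_EFinP; exact: measurable_expRM.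
rewrite ge0_integral_measure_add//.
rewrite !ge0_integral_mscale//.
rewrite intE// ?integral_expR_exponential_prob// integral_dirac//.
by rewrite mulr0 expR0 mule1 muleA -EFinM.
Qed.

Lemma ber_exp_rv_itvoy (p l t : R) X : ber_exp_rv p l X -> 0 <= t ->
  pushforward P X `]t, +oo[%classic = (p * expR (- l * t))%:E.
Proof.
move=> [_ _ tX] t0; rewrite -tX// /pushforward; congr (P _).
by apply/seteqP; split=> w /=; rewrite in_itv/= andbT.
Qed.

Lemma expectation_expR_ber_exp_rv (p l a : R) X :
  ber_exp_param p l -> ber_exp_rv p l X -> a < l ->
  (\int[P]_w (expR (a * X w))%:E = (p * (l / (l - a)) + (1 - p))%:E)%E.
Proof.
move=> hpl hX al; have [mX _ _] := hX.
have := integral_ber_exp_rv hpl hX al measurableT.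
have -> : exponential_prob (l - a) setT = 1%E.
  by rewrite /exponential_prob integral_exponential_pdf// subr_gt0.
rewrite diracT !mule1 -EFinD => <-.
rewrite ge0_integral_pushforward//.
by apply/measurable_EFinP; exact: measurable_expRM.
Qed.

Lemma independent_pairC X Y : independent_pair P X Y -> independent_pair P Y X.
Proof.
move=> [mX mY iXY]; split=> // B C mB mC.
by rewrite setIC iXY// muleC.
Qed.

(** The product rule passes from rays to Borel sets in one variable, then in the other; for a
    negative threshold the ray is the sure event. *)
Lemma independent_pair_tails (X Y : T -> R) :
  measurable_fun setT X -> measurable_fun setT Y ->
  (forall w, 0 <= X w) -> (forall w, 0 <= Y w) ->
  (forall s t, 0 <= s -> 0 <= t ->
    P [set w | s < X w /\ t < Y w] =
    (P [set w | (s < X w)%R] * P [set w | (t < Y w)%R])%E) ->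
  independent_pair P X Y.
Proof.
move=> mX mY X0 Y0 XY.
have {}XY s t : P [set w | s < X w /\ t < Y w] =
    (P [set w | (s < X w)%R] * P [set w | (t < Y w)%R])%E.
  have [s0|s0] := ltP s 0.
    have -> : [set w | s < X w] = setT.
      by apply/seteqP; split=> // w _ /=; exact: lt_le_trans (X0 w).
    rewrite probability_setT mul1e; congr (P _); apply/seteqP.
    by split=> w /=; [case|split=> //; exact: lt_le_trans (X0 w)].
  have [t0|t0] := ltP t 0; last exact: XY.
  have -> : [set w | t < Y w] = setT.
    by apply/seteqP; split=> // w _ /=; exact: lt_le_trans (Y0 w).
  rewrite probability_setT mule1; congr (P _); apply/seteqP.
  by split=> w /=; [case|split=> //; exact: lt_le_trans (Y0 w)].
have rays (Z : T -> R) (Q : set T) :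
    measurable_fun setT Z -> measurable Q ->
    (forall t, P ([set w | t < Z w] `&` Q) = (P [set w | (t < Z w)%R] * P Q)%E) ->
    forall B, measurable B -> P (Z @^-1` B `&` Q) = (P (Z @^-1` B) * P Q)%E.
  move=> mZ mQ h B mB.
  have Qfin : P Q \is a fin_num by exact: fin_num_measure.
  have Q0 : 0 <= fine (P Q) by exact: fine_ge0.
  pose c : {nonneg R} := NngNum Q0.
  pose Z' : {RV P >-> R} := HB.pack Z (isMeasurableFun.Build _ _ _ _ _ mZ).
  pose m1 : {measure set R -> \bar R} := pushforward (mrestr P mQ) Z'.
  pose m2 : {measure set R -> \bar R} := mscale c (distribution P Z').
  rewrite -[RHS]muleC -[X in (X * _)%E](fineK Qfin).
  suff: m1 mZ B = m2 B by [].
  apply: eq_measure_rays => //.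
    by rewrite /m1 /= /pushforward /mrestr preimage_setT setTI ltey_eq Qfin.
  move=> t; rewrite /m1 /m2 /= /distribution /pushforward /mrestr /mscale/= fineK//.
  have E : Z @^-1` `]t, +oo[ = [set w | t < Z w].
    by apply/seteqP; split=> w /=; rewrite in_itv/= andbT.
  have -> : distribution P Z' `]t, +oo[%classic = P [set w | t < Z w] by rewrite -E.
  by rewrite E h muleC.
have mr (Z : T -> R) t : measurable_fun setT Z -> measurable [set w | t < Z w].
  move=> mZ; have -> : [set w | t < Z w] = Z @^-1` `]t, +oo[.
    by apply/seteqP; split=> w /=; rewrite in_itv/= andbT.
  exact: measurable_fun_preimage.
split=> // B C mB mC; apply: (rays _ _) => //; first exact: measurable_fun_preimage.
move=> s; rewrite setIC [RHS]muleC; apply: (rays _ _) => //; first exact: mr.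
by move=> t; rewrite muleC -XY; congr (P _); apply/seteqP; split=> w /= [].
Qed.

Lemma measurable_fun_ray (X : T -> R) t : measurable_fun setT X -> measurable [set w : T | t < X w].
Proof.
move=> mX; have -> : [set w | t < X w] = X @^-1` `]t, +oo[.
  by apply/seteqP; split=> w /=; rewrite in_itv/= andbT.
exact: measurable_fun_preimage.
Qed.

Lemma independent_pair_rays (X Y : T -> R) s t : independent_pair P X Y ->
  P [set w | s < X w /\ t < Y w] = (P [set w | (s < X w)%R] * P [set w | (t < Y w)%R])%E.
Proof.
move=> [mX mY iXY]; have := iXY `]s, +oo[%classic `]t, +oo[%classic.
have E Z u : Z @^-1` `]u, +oo[ = [set w : T | u < Z w].
  by apply/seteqP; split=> w /=; rewrite in_itv/= andbT.
by rewrite !E => <-.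
Qed.


Lemma exponential_prob_itvNyc (l t : R) : 0 < l -> 0 <= t ->
  exponential_prob l `]-oo, t]%classic = (1 - expR (- l * t))%:E.
Proof.
move=> l0 t0; have [e eE _] := exponential_measure l0.
have eT : (e setT = 1)%E.
  by rewrite eE /exponential_prob integral_exponential_pdf.
have /(congr1 (fun z => z - (expR (- l * t))%:E)%E) :
    (e `]-oo, t]%classic + (expR (- l * t))%:E = 1)%E.
  rewrite -(exponential_prob_itvoy l0 t0) -eE -eT -measureU//.
    by congr (e _); rewrite -setCitvr setvU.
  by rewrite -setCitvr setICl.
by rewrite addeK// eE.
Qed.

Lemma exponential_prob_itvcy (l : R) : 0 < l ->
  exponential_prob l `[0, +oo[%classic = 1%E.
Proof.
move=> l0; rewrite -[RHS](integral_exponential_pdf l0) /exponential_prob.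
rewrite [LHS]integral_mkcond/=.
apply: eq_integral => x _; rewrite patchE; case: ifPn => // xt.
rewrite lt0_exponential_pdf//.
by move: xt; rewrite notin_setE/= in_itv/= andbT => /negP; rewrite -ltNge.
Qed.

(** The resulting parameter is the probability that [W] or [A] is positive. The terms in
    [expR (- (1 + g) * t)] cancel because the parameter of [A] is [(1 + g)^-1]. *)
Lemma ber_exp_rv_add (p g : R) (W A : T -> R) : 0 <= p <= 1 -> 0 < g ->
  independent_pair P W A ->
  ber_exp_rv p (1 + g) W -> ber_exp_rv (1 + g)^-1 g A ->
  ber_exp_rv ((1 + g)^-1 + p - (1 + g)^-1 * p) g (fun w => W w + A w).
Proof.
move=> p01 g0 iWA hW hA; have [mW W0 tW] := hW; have [mA A0 tA] := hA.
split=> [|w|t t0]; [exact: measurable_funD|exact: addr_ge0|].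
pose E : set (R * R) := [set x | t < x.1 + x.2].
have mE : measurable E.
  have -> : E = (fun x => x.1 + x.2) @^-1` `]t, +oo[.
    by apply/seteqP; split=> x /=; rewrite in_itv/= andbT.
  rewrite -[X in measurable X]setTI; apply: measurable_funD => //.
rewrite [LHS](independent_pair_integral iWA mE) /E/=.
pose c := (1 + g)^-1 * expR (- g * t).
have c0 : 0 <= c by rewrite mulr_ge0 ?invr_ge0 ?expR_ge0// addr_ge0// ltW.
pose D1 : set R := `]-oo, t]%classic.
pose D2 : set R := `]t, +oo[%classic.
pose f (x : R) := (expR (g * x))%:E.
have mf : measurable_fun setT f by apply/measurable_EFinP; exact: measurable_expRM.
(* Given [W = x], the sum exceeds [t] with the tail probability of [A] at [t - x] if [x <= t], and
   almost surely if [x > t]. *)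
transitivity (\int[pushforward P W]_x (c%:E * (f \_ D1) x + (\1_D2 x)%:E))%E.
  apply: eq_integral => [|x _]; first exact: mW.
  have -> : [set w | t < x + A w] = [set w | t - x < A w].
    by apply/seteqP; split=> w /=; rewrite ltrBlDl.
  rewrite patchE indicE; have [xt|xt] := leP x t.
    rewrite mem_set/=; last by rewrite /D1/= in_itv/=.
    rewrite memNset/=; last by rewrite /D2/= in_itv/= andbT; apply/negP; rewrite -leNgt.
    rewrite tA ?subr_ge0// adde0 -EFinM /c -mulrA -expRD.
    by congr (_ * expR _)%:E; ring.
  rewrite memNset/=; last by rewrite /D1/= in_itv/=; apply/negP; rewrite -ltNge.
  rewrite mem_set/=; last by rewrite /D2/= in_itv/= andbT.
  by rewrite mule0 add0e (ber_exp_rv_lt0 hA)// subr_lt0.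
have mD1 : measurable D1 by exact: measurable_itv.
have mD2 : measurable D2 by exact: measurable_itv.
have mfD1 : measurable_fun setT (f \_ D1).
  by apply/(measurable_restrictT _ mD1); exact: measurable_funTS.
have f0 x : (0 <= (f \_ D1) x)%E.
  by rewrite patchE; case: ifP => // _; rewrite lee_fin expR_ge0.
rewrite ge0_integralD//=; last 3 first.
- by move=> x _; rewrite mule_ge0.
- exact: emeasurable_funM.
- exact/measurable_EFinP/measurable_indic.
rewrite ge0_integralZl//= -integral_mkcond.
rewrite (integral_ber_exp_rv (a := g) (conj p01 (addr_gt0 ltr01 g0)) hW)//; last first.
  by rewrite ltrDr.
have -> : (\int[pushforward P W]_x (\1_D2 x)%:E =
    (p * expR (- (1 + g) * t))%:E)%E.
  by rewrite integral_indic// setIT; exact: (ber_exp_rv_itvoy hW t0).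
rewrite addrK divr1.
rewrite exponential_prob_itvNyc// diracE mem_set/=; last by rewrite /D1/= in_itv/=.
rewrite mule1 -!(EFinM, EFinD); congr (_%:E).
have -> : expR (- (1 + g) * t) = expR (- g * t) * expR (- 1 * t).
  by rewrite -expRD; congr expR; ring.
rewrite /c; set u := expR _; set v := expR _.
by field; rewrite gt_eqF// addr_gt0.
Qed.

(* Lack of memory: given [S] and [S < X], the excess [X - S] is again
   exponential of rate [g]. *)
Lemma ber_exp_rv_excess (c g q : R) (X S : T -> R) (B : set R) (t : R) :
  0 <= c <= 1 -> 0 <= q <= 1 -> 0 < g ->
  independent_pair P X S -> ber_exp_rv c g X -> ber_exp_rv q 1 S ->
  measurable B -> B `<=` `[0, +oo[%classic -> 0 <= t ->
  P [set w | B (S w) /\ t < X w - S w] =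
  ((c * expR (- g * t))%:E *
   ((q / (1 + g))%:E * exponential_prob (1 + g) B + (1 - q)%:E * \d_(0%R : R) B))%E.
Proof.
move=> /andP[c0 c1] q01 g0 /independent_pairC iXS hX hS mB B0 t0.
have [mX X0 tX] := hX; have [mS S0 tS] := hS.
pose E : set (R * R) := [set x | B x.1 /\ t < x.2 - x.1].
have mE : measurable E.
  have -> : E = (fst @^-1` B) `&` (fun x => x.2 - x.1) @^-1` `]t, +oo[.
    by apply/seteqP; split=> x /=; rewrite in_itv/= andbT.
  apply: measurableI.
    by rewrite -[X in measurable X]setTI; exact: measurable_fst.
  rewrite -[X in measurable X]setTI; apply: measurable_funB => //.
rewrite [LHS](independent_pair_integral iXS mE) /E/=.
pose k := c * expR (- g * t).
have k0 : 0 <= k by rewrite mulr_ge0 ?expR_ge0.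
pose f (x : R) := (expR (- g * x))%:E.
have mf : measurable_fun setT f by apply/measurable_EFinP; exact: measurable_expRM.
transitivity (\int[pushforward P S]_x (k%:E * (f \_ B) x))%E.
  apply: eq_integral => [|x _]; first exact: mS.
  rewrite patchE; case: ifPn => xB.
    have x0 : 0 <= x by move: xB; rewrite inE => /B0; rewrite /= in_itv/= andbT.
    have -> : [set w | B x /\ t < X w - x] = [set w | t + x < X w].
      apply/seteqP; split=> w /=; first by move=> []; rewrite ltrBrDr.
      by rewrite ltrBrDr => h; split=> //; move: xB; rewrite inE.
    rewrite tX ?addr_ge0// -EFinM /k -mulrA -expRD.
    by congr (_ * expR _)%:E; ring.
  rewrite mule0 -(measure0 P); congr (P _); apply/seteqP; split=> w //= [].
  by move: xB; rewrite notin_setE.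
have mfB : measurable_fun setT (f \_ B).
  by apply/(measurable_restrictT _ mB); exact: measurable_funTS.
have f0 x : (0 <= (f \_ B) x)%E.
  by rewrite patchE; case: ifP => // _; rewrite lee_fin expR_ge0.
rewrite ge0_integralZl//= -integral_mkcond.
rewrite (integral_ber_exp_rv (a := - g) (conj q01 ltr01) hS)//; last first.
  by rewrite (lt_trans _ ltr01)// oppr_lt0.
by rewrite opprK div1r.
Qed.

(* The weight of the atom of [X] at 0 is exactly the one for which [D = 0] is
   independent of the value of [M]. *)
Lemma ber_exp_rv_serve (q g : R) (X S : T -> R) :
  0 <= q <= 1 -> 0 < g ->
  independent_pair P X S ->
  ber_exp_rv (1 + (1 - q) * g)^-1 g X -> ber_exp_rv q 1 S ->
  let M := fun w => Num.min (X w) (S w) in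
  let D := fun w => Num.max (X w - S w) 0 in
  [/\ independent_pair P M D, ber_exp_rv (q / (1 + (1 - q) * g)) (1 + g) M
    & ber_exp_rv (1 + g)^-1 g D].
Proof.
move=> q01 g0 iXS hX hS M D; have /andP[q0 q1] := q01.
have [mX X0 tX] := hX; have [mS S0 tS] := hS.
set c := (1 + (1 - q) * g)^-1 in hX tX *.
have h0 : 1 <= 1 + (1 - q) * g by rewrite lerDl mulr_ge0 ?subr_ge0// ltW.
have h1 : 0 < 1 + (1 - q) * g := lt_le_trans ltr01 h0.
have g1 : 0 < 1 + g by rewrite addr_gt0.
have c01 : 0 <= c <= 1 by rewrite invr_ge0 ltW//= invf_le1.
have mM : measurable_fun setT M by exact: measurable_minr.
have mD : measurable_fun setT D.
  by apply: measurable_maxr => //; exact: measurable_funB.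
have M0 w : 0 <= M w by rewrite le_min X0 S0.
have D0 w : 0 <= D w by rewrite le_max lexx orbT.
have tM t : 0 <= t ->
    P [set w | t < M w] = (q * c * expR (- (1 + g) * t))%:E.
  move=> t0; have := independent_pair_rays t t iXS.
  have -> : [set w | t < X w /\ t < S w] = [set w | t < M w].
    by apply/seteqP; split=> w /=; rewrite lt_min => /andP.
  move=> ->; rewrite tX// tS// -EFinM; congr (_%:E).
  by rewrite mulrACA -expRD [c * q]mulrC; congr (_ * expR _); ring.
have DE t w : 0 <= t -> (t < D w) = (t < X w - S w).
  by move=> t0; rewrite lt_max [t < 0]ltNge t0 orbF.
have tD t : 0 <= t -> P [set w | t < D w] = ((1 + g)^-1 * expR (- g * t))%:E.
  move=> t0.
  have := ber_exp_rv_excess c01 q01 g0 iXS hX hS (measurable_itv `[0, +oo[) (fun x h => h) t0.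
  have -> : [set w | `[0, +oo[%classic (S w) /\ t < X w - S w] = [set w | t < D w].
    apply/seteqP; split=> w /=; rewrite in_itv/= andbT DE//; by case.
  move=> ->; rewrite exponential_prob_itvcy// diracE mem_set/= ?in_itv/= ?lexx//.
  rewrite !mule1 -EFinD -EFinM; congr (_%:E).
  by rewrite /c; field; rewrite !gt_eqF.
split=> //; apply: independent_pair_tails => // s t s0 t0.
rewrite tM// tD//.
have sub : (`]s, +oo[%classic : set R) `<=` `[0, +oo[%classic.
  by apply: subset_itvr; rewrite bnd_simp.
have := ber_exp_rv_excess c01 q01 g0 iXS hX hS (measurable_itv `]s, +oo[) sub t0.
have -> : [set w | `]s, +oo[%classic (S w) /\ t < X w - S w] =
    [set w | s < M w /\ t < D w].
  apply/seteqP; split=> w /=; rewrite in_itv/= andbT DE// lt_min.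
    move=> [sS tXS]; split=> //; rewrite sS andbT (lt_trans sS)//.
    by rewrite -subr_gt0 (le_lt_trans t0).
  by move=> [/andP[_ ->]].
move=> ->; rewrite exponential_prob_itvoy// diracE memNset/=; last first.
  by rewrite in_itv/= andbT; apply/negP; rewrite -leNgt.
rewrite mule0 adde0 -!EFinM; congr (_%:E).
set u := expR _; set v := expR _.
by rewrite /c; field; rewrite !gt_eqF.
Qed.

End ber_exp.

(** * Changing the parameter and the rate of a variable *)

Section boundary.
Context (R : realType) (d : measure_display) (T : measurableType d)
  (P : probability T R).

(** By lack of memory the excess over [c] is positive with probability [p * expR (- c)] and then
    again exponential. This lowers the parameter; the division sets the rate. *)
Lemma ber_exp_rv_scale (p c l : R) (X : T -> R) :
  0 < l -> 0 <= c -> ber_exp_rv P p 1 X ->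
  ber_exp_rv P (p * expR (- c)) l (fun w => Num.max (X w - c) 0 / l).
Proof.
move=> l0 c0 [mX X0 tX]; split=> [|w|t t0].
- apply: measurable_funM => //; apply: measurable_maxr => //.
  exact: measurable_funB.
- by rewrite divr_ge0 ?le_max ?lexx ?orbT// ltW.
- have -> : [set w | t < Num.max (X w - c) 0 / l] = [set w | t * l + c < X w].
    have tl : 0 <= t * l by rewrite mulr_ge0// ltW.
    apply/seteqP; split=> w /=; rewrite ltr_pdivlMr// lt_max [_ < 0]ltNge tl orbF.
      by rewrite ltrBrDr.
    by rewrite ltrBrDr.
  rewrite tX; last by rewrite addr_ge0// mulr_ge0// ltW.
  by rewrite -mulrA -expRD; congr (_ * expR _)%:E; ring.
Qed.

(** Filling the zeros of [X] with [Y] raises the parameter and keeps the rate. *)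
Lemma ber_exp_rv_merge (p q l : R) (X Y : T -> R) :
  independent_pair P X Y -> ber_exp_rv P p l X -> ber_exp_rv P q l Y ->
  ber_exp_rv P (p + (1 - p) * q) l (fun w => if 0 < X w then X w else Y w).
Proof.
move=> iXY hX hY; have [mX X0 tX] := hX; have [mY Y0 tY] := hY.
have [_ _ iXYE] := iXY.
have mpos : measurable_fun setT (fun w => 0 < X w).
  exact: measurable_fun_ltr.
split=> [|w|t t0]; [exact: measurable_fun_ifT|by case: ifP|].
have iE : ([set w | X w <= 0] = X @^-1` `]-oo, 0])%classic.
  by apply/seteqP; split=> w /=; rewrite in_itv.
have tE : ([set w | t < Y w] = Y @^-1` `]t, +oo[)%classic.
  by apply/seteqP; split=> w /=; rewrite in_itv/= andbT.
have P0 : P [set w | X w <= 0] = (1 - p)%:E.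
  have -> : [set w | X w <= 0] = ~` [set w | 0 < X w].
    by apply/seteqP; split=> w /=; [rewrite leNgt => /negP|move/negP; rewrite -leNgt].
  rewrite probability_setC; last exact: measurable_fun_ray.
  by rewrite tX// mulr0 expR0 mulr1.
have -> : [set w | t < (if 0 < X w then X w else Y w)] =
    [set w | t < X w] `|` ([set w | X w <= 0] `&` [set w | t < Y w]).
  apply/seteqP; split=> w /=.
    by case: ifPn => Xw tw; [left|right; rewrite leNgt].
  case: ifPn => [Xw|/negP Xw] [tw|[Xw' tw]] //; first by rewrite ltNge Xw' in Xw.
  by case: Xw; exact: le_lt_trans tw.
rewrite measureU.
- transitivity ((p * expR (- l * t))%:E + (1 - p)%:E * (q * expR (- l * t))%:E)%E.
    congr (_ + _)%E; first exact: tX.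
    by rewrite -P0 -(tY _ t0) iE tE; exact: iXYE.
  by rewrite -EFinM -EFinD; congr (_%:E); ring.
- exact: measurable_fun_ray.
- by rewrite iE tE; apply: measurableI; exact: measurable_fun_preimage.
- apply/seteqP; split=> // w /= [tw [Xw _]].
  by move: (le_lt_trans t0 tw); rewrite ltNge Xw.
Qed.

Lemma independent_pair_cst (X : T -> R) (c : R) :
  measurable_fun setT X -> independent_pair P X (fun=> c).
Proof.
move=> mX; split=> // B C mB mC.
have [cC|cC] := pselect (C c).
  have -> : (fun=> c) @^-1` C = [set: T] by apply/seteqP; split.
  by rewrite setIT probability_setT mule1.
have -> : (fun=> c) @^-1` C = set0 :> set T by apply/seteqP; split.
by rewrite setI0 measure0 mule0.
Qed.

End boundary.

(** * The recursion on the quadrant and its increments *)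

Section quadrant.
Context (R : realType).
Implicit Types (s : nat -> nat -> R) (W A : nat -> R).

(* The passage-time recursion on the quadrant, with prescribed increments
   [W] along the horizontal axis and decrements [A] along the vertical one;
   the weight [s k l] sits at the vertex [(k.+1, l.+1)]. *)
Fixpoint quadrant s W A (k : nat) : nat -> R :=
  match k with
  | 0 => fun l => - \sum_(j < l) A j
  | k'.+1 => fix row l := match l with
    | 0 => \sum_(i < k'.+1) W i
    | l'.+1 => Num.min (row l') (quadrant s W A k' l'.+1 + s k' l')
    end
  end.

Lemma quadrant0l s W A l : quadrant s W A 0 l = - \sum_(j < l) A j.
Proof. by []. Qed.

Lemma quadrantk0 s W A k : quadrant s W A k 0 = \sum_(i < k) W i.
Proof. by case: k => //=; rewrite !big_ord0 oppr0. Qed.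

Lemma quadrantSS s W A k l : quadrant s W A k.+1 l.+1 =
  Num.min (quadrant s W A k.+1 l) (quadrant s W A k l.+1 + s k l).
Proof. by []. Qed.

Definition hincr s W A k l := quadrant s W A k.+1 l - quadrant s W A k l.
Definition vdecr s W A k l := quadrant s W A k l - quadrant s W A k l.+1.

Lemma hincr0 s W A k : hincr s W A k 0 = W k.
Proof. by rewrite /hincr !quadrantk0 big_ord_recr/=; ring. Qed.

Lemma vdecr0 s W A l : vdecr s W A 0 l = A l.
Proof. by rewrite /vdecr !quadrant0l big_ord_recr/=; ring. Qed.

(** Together with [vdecrS]: if [X] is the sum of the incoming increment and decrement, the outgoing
    ones are [min(X, s)] and [max(X - s, 0)], the map treated in [ber_exp_rv_serve]. *)
Lemma hincrS s W A k l : hincr s W A k l.+1 =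
  Num.min (hincr s W A k l + vdecr s W A k l) (s k l).
Proof.
rewrite /hincr /vdecr quadrantSS addr_minl; congr Num.min; ring.
Qed.

Lemma vdecrS s W A k l : vdecr s W A k.+1 l =
  Num.max (hincr s W A k l + vdecr s W A k l - s k l) 0.
Proof.
rewrite /hincr /vdecr quadrantSS oppr_min addr_maxr subrr maxC; congr Num.max; ring.
Qed.

End quadrant.

(** * The Burke property propagated through the quadrant *)

Section burke.
Context (R : realType) (d : measure_display) (T : measurableType d)
  (P : probability T R) (q g : R) (B : nat * nat -> T -> R).

Definition bulk_weights w : nat -> nat -> R := fun i j => B (i.+1, j.+1) w.
Definition bottom_incr w : nat -> R := fun i => B (i.+1, 0) w.
Definition left_decr w : nat -> R := fun j => B (0, j.+1) w.

(* The boundary laws preserved by the recursion: the paper's parameter is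
   [r = 1 / (1 + g)]. *)
Definition stationary_data := [/\ independent_family P B,
  forall i, ber_exp_rv P (q / (1 + (1 - q) * g)) (1 + g) (B (i.+1, 0)),
  forall j, ber_exp_rv P (1 + g)^-1 g (B (0, j.+1)) &
  forall i j, ber_exp_rv P q 1 (B (i.+1, j.+1))].

Let h k l w := hincr (bulk_weights w) (bottom_incr w) (left_decr w) k l.
Let v k l w := vdecr (bulk_weights w) (bottom_incr w) (left_decr w) k l.

(* The variables carried by the down-right path which has absorbed the rows
   below [l] and the first [k] vertices of row [l], together with the weights
   not yet used; a variable already consumed is replaced by 0. *)
Definition swept l k (p : nat * nat) : T -> R :=
  match p with
  | (0, 0) => B (0, 0)
  | (i.+1, 0) => if (i < k)%N then h i l.+1 else h i l
  | (i, j.+1) => if (j < l)%N then fun=> 0 else if j == l then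
      (if (i < k)%N then fun=> 0 else if i == k then v k l else B (i, j.+1))
      else B (i, j.+1)
  end.

Lemma sweptS l k i j : swept l k (i, j.+1) =
  if (j < l)%N then fun=> 0 else if j == l then
    (if (i < k)%N then fun=> 0 else if i == k then v k l else B (i, j.+1))
    else B (i, j.+1).
Proof. by case: i. Qed.

Definition swept_spec l k := [/\ independent_family P (swept l k),
  forall i, ber_exp_rv P (q / (1 + (1 - q) * g)) (1 + g) (swept l k (i.+1, 0)) &
  ber_exp_rv P (1 + g)^-1 g (v k l)].

Context (q01 : 0 <= q <= 1) (g0 : 0 < g) (B_spec : stationary_data).

Let pW01 : 0 <= q / (1 + (1 - q) * g) <= 1.
Proof.
have /andP[q0 q1] := q01.
have h0 : 0 <= (1 - q) * g by rewrite mulr_ge0 ?subr_ge0// ltW.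
have h1 : 0 < 1 + (1 - q) * g by apply: ltr_wpDr.
rewrite divr_ge0 ?(ltW h1)//= ler_pdivrMr// mul1r (le_trans q1)//.
by rewrite lerDl.
Qed.

(** The parameter produced by [ber_exp_rv_add] is the one that [ber_exp_rv_serve] requires. *)
Let pE : (1 + g)^-1 + q / (1 + (1 - q) * g) - (1 + g)^-1 * (q / (1 + (1 - q) * g))
  = (1 + (1 - q) * g)^-1.
Proof.
have /andP[q0 q1] := q01.
have h0 : 0 <= (1 - q) * g by rewrite mulr_ge0 ?subr_ge0// ltW.
have h1 : 0 < 1 + (1 - q) * g by apply: ltr_wpDr.
by field; rewrite !gt_eqF// addr_gt0.
Qed.

(** A vertex has three inputs while an update treats two, so it is crossed in two updates: [(W, A)]
    becomes [(W + A, 0)], then [(W + A, S)] becomes the outgoing pair. *)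
Lemma swept_step l k : swept_spec l k -> swept_spec l k.+1.
Proof.
move=> [iZ hW hA]; have [iB BW BA BS] := B_spec.
pose iw : nat * nat := (k.+1, 0); pose ia : nat * nat := (k, l.+1).
pose ib : nat * nat := (k.+1, l.+1).
have Ziw : swept l k iw = h k l by rewrite /iw /= ltnn.
have Zia : swept l k ia = v k l.
  by rewrite /ia; case: (k) => [|k'] /=; rewrite ltnn eqxx ?ltnn ?eqxx.
have Zis : swept l k ib = B ib.
  by rewrite /ib /= ltnn eqxx ltnNge leqnSn/= gtn_eqF.
(* The family between the two updates: the sum is stored at [iw], and [ia] is emptied. *)
pose Z1 p := if p == iw then (fun w => h k l w + v k l w)
  else if p == ia then fun=> 0 else swept l k p.
have wa : iw != ia by rewrite /iw /ia xpair_eqE andbF.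
have iwa : independent_pair P (h k l) (v k l).
  by rewrite -Ziw -Zia; exact: independent_family_pair.
have hX : ber_exp_rv P (1 + (1 - q) * g)^-1 g (fun w => h k l w + v k l w).
  rewrite -pE; apply: ber_exp_rv_add => //.
  by rewrite -Ziw; exact: hW.
have [mX _ _] := hX.
have Z1a : Z1 ia = fun=> 0 by rewrite /Z1 eq_sym (negbTE wa) eqxx.
have Z1w : Z1 iw = fun w => h k l w + v k l w by rewrite /Z1 eqxx.
have iZ1 : independent_family P Z1.
  apply: (@independent_family_update2 _ _ _ P _ (swept l k) Z1 iw ia
    (fun x => x.1 + x.2) (fun=> 0) wa) => //.
  - exact: measurable_funD.
  - by rewrite Z1w Ziw Zia.
  - by move=> p piw pia; rewrite /Z1 (negbTE piw) (negbTE pia).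
  - by rewrite Z1w Z1a; apply: independent_pair_cst.
have ws : iw != ib by rewrite /iw /ib xpair_eqE andbF.
have Z1s : Z1 ib = B ib.
  rewrite /Z1 eq_sym (negbTE ws) (_ : (ib == ia) = false) ?Zis//.
  by rewrite /ib /ia xpair_eqE gtn_eqF.
have := @ber_exp_rv_serve _ _ _ P q g (Z1 iw) (Z1 ib) q01 g0 (independent_family_pair ws iZ1).
rewrite Z1w Z1s => /(_ hX (BS k l)) /=.
set M := fun w => _; set D := fun w => _; move=> [iMD hM hD].
have ME : M = h k l.+1.
  by apply/funext => w; rewrite /M /h hincrS.
have DE : D = v k.+1 l.
  by apply/funext => w; rewrite /D /v vdecrS.
rewrite ME in hM iMD; rewrite DE in hD iMD.
have Z2w : swept l k.+1 iw = h k l.+1 by rewrite /iw /= ltnS leqnn.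
have Z2s : swept l k.+1 ib = v k.+1 l by rewrite /ib /= ltnn eqxx ltnn eqxx.
split=> //.
- apply: (@independent_family_update2 _ _ _ P _ Z1 (swept l k.+1) iw ib
    (fun x => Num.min x.1 x.2) (fun x => Num.max (x.1 - x.2) 0) ws) => //.
  + exact: measurable_minr.
  + by apply: measurable_maxr => //; exact: measurable_funB.
  + by rewrite Z2w Z1w Z1s -ME.
  + by rewrite Z2s Z1w Z1s -DE.
  + move=> [i j] pw ps; rewrite /Z1 (negbTE pw).
    move: pw ps; rewrite /iw /ib /ia !xpair_eqE.
    case: j => [|j]; rewrite ?andbT ?andbF ?eqSS.
      case: i => [|i]//=; rewrite ?eqSS => ik _.
      by rewrite ltnS leq_eqVlt (negbTE ik).
    move=> _; rewrite !sweptS; case: (eqVneq j l) => [->|jl]; rewrite ?andbT ?andbF//.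
    rewrite ltnn => ik; have [->|ik'] := eqVneq i k; first by rewrite ltnSn.
    by rewrite ltnS leq_eqVlt (negbTE ik') (negbTE ik).
  + by rewrite Z2w Z2s.
- move=> i; have [->|ik] := eqVneq i k; first by rewrite Z2w.
  have := hW i; rewrite /= ltnS (leq_eqVlt i k) (negbTE ik).
  by [].
Qed.

Lemma sweptP l : swept_spec l 0.
Proof.
have [iB BW BA BS] := B_spec.
elim: l => [|l IH].
  have E p : B p = swept 0 0 p.
    case: p => -[|i] [|j] //=.
    - by case: j => //=; apply/funext => w; rewrite /v vdecr0.
    - by apply/funext => w; rewrite /h hincr0.
    - by case: j.
  split.
  - exact: independent_family_eq E iB.
  - by move=> i; rewrite -E.
  - by have -> : v 0 0 = B (0, 1); [rewrite (E (0, 1)%N)|exact: BA].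
have IHk k : swept_spec l k by elim: k => // k; exact: swept_step.
have hE i : swept l.+1 0 (i.+1, 0) = h i l.+1 by [].
split.
(* A finished row is a limit in [k]: the entry at [(i, j)] has reached its final value once
   [k > i]. *)
- apply: (@independent_family_lim _ _ _ P _ (swept l)).
    by move=> k; have [] := IHk k.
  move=> [i j]; exists i.+1 => k ik; case: j => [|j].
    by case: i ik => [|i]//= ik; rewrite (ltn_trans _ ik).
  rewrite !sweptS.
  rewrite ik ltn0; case: (ltngtP j l) => jl.
  + by rewrite ltnS (ltnW jl).
  + rewrite ltnS leqNgt jl /=; case: (eqVneq j l.+1) => // ->.
    case: (eqVneq i 0) => // ->.
    by apply/funext => w; rewrite /v vdecr0.
  + by rewrite jl ltnSn.
- move=> i; rewrite hE; have [_ /(_ i) + _] := IHk i.+1.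
  by rewrite /= ltnSn.
- have -> : v 0 l.+1 = B (0, l.+2); last exact: BA.
  by apply/funext => w; rewrite /v vdecr0.
Qed.

Lemma stationary_row l :
  independent_family P (fun i w => hincr (bulk_weights w) (bottom_incr w) (left_decr w) i l) /\
  forall i, ber_exp_rv P (q / (1 + (1 - q) * g)) (1 + g)
    (fun w => hincr (bulk_weights w) (bottom_incr w) (left_decr w) i l).
Proof.
have [iZ hW _] := sweptP l; split; last exact: hW.
apply: (@independent_family_can _ _ _ P (nat * nat)%type nat
  (fun i => (i.+1, 0)) (fun p => p.1.-1) _ _ iZ).
by [].
Qed.

End burke.

(** * Exponential deviation bounds and a strong law for arrays *)

Section large_numbers.
Context (R : realType) (d : measure_display) (T : measurableType d)
  (P : probability T R).

Lemma integral_independent_pairM (X Y : T -> R) (f g : R -> R) :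
  independent_pair P X Y ->
  measurable_fun setT f -> measurable_fun setT g ->
  (forall x, 0 <= f x) -> (forall x, 0 <= g x) ->
  (\int[P]_w (f (X w) * g (Y w))%:E =
   \int[P]_w (f (X w))%:E * \int[P]_w (g (Y w))%:E)%E.
Proof.
move=> [mX mY iXY] mf mg f0 g0.
pose X' : {RV P >-> R} := HB.pack X (isMeasurableFun.Build _ _ _ _ _ mX).
pose Y' : {RV P >-> R} := HB.pack Y (isMeasurableFun.Build _ _ _ _ _ mY).
have mXY : measurable_fun setT (fun w => (X w, Y w)) by apply/measurable_fun_pair.
pose Z : {RV P >-> (R * R)%type} := HB.pack (fun w => (X w, Y w))
  (isMeasurableFun.Build _ _ _ _ _ mXY).
have joint (E : set (R * R)) : measurable E ->
    distribution P Z E = (distribution P X' \x distribution P Y')%E E.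
  move=> mE; apply/esym; apply: product_measure_unique => //.
have mEf : measurable_fun setT (fun x => (f x)%:E) by exact/measurable_EFinP.
have mEg : measurable_fun setT (fun x => (g x)%:E) by exact/measurable_EFinP.
pose h (x : R * R) := ((f x.1)%:E * (g x.2)%:E)%E.
have mh : measurable_fun setT h.
  apply: emeasurable_funM; first exact: (measurableT_comp mEf measurable_fst).
  exact: (measurableT_comp mEg measurable_snd).
have h0 x : (0 <= h x)%E by rewrite mule_ge0// lee_fin.
transitivity (\int[distribution P Z]_x h x)%E.
  by rewrite ge0_integral_distribution.
rewrite (eq_measure_integral (distribution P X' \x distribution P Y')%E); last first.
  by move=> A mA _; exact: joint.
rewrite fubini_tonelli1//= /fubini_F /h/=.
transitivity (\int[distribution P X']_x ((f x)%:E * \int[distribution P Y']_y (g y)%:E))%E.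
  apply: eq_integral => x _; rewrite ge0_integralZl//.
    by move=> y _; rewrite lee_fin.
  by rewrite lee_fin.
have Eg0 : (0 <= \int[distribution P Y']_y (g y)%:E)%E.
  by apply: integral_ge0 => y _; rewrite lee_fin.
rewrite ge0_integralZr//; last by move=> x _; rewrite lee_fin.
by rewrite !ge0_integral_distribution// => y; rewrite lee_fin.
Qed.

(** The partial sum is collected at index 0, one term at a time, each absorbed entry becoming 0. *)
Lemma independent_pair_sum (Y : nat -> T -> R) n : independent_family P Y ->
  independent_pair P (fun w => \sum_(i < n.+1) Y i w) (Y n.+1).
Proof.
move=> iY.
pose V n i w := if i == 0 then \sum_(j < n.+1) Y j w
  else if (i <= n)%N then 0 else Y i w.
have iV m : independent_family P (V m).
  elim: m => [|m IH].
    apply: independent_family_eq iY => -[|i]; apply/funext => w; rewrite /V//=.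
    by rewrite big_ord_recl big_ord0 addr0.
  have mn : 0 != m.+1 by [].
  have V0 : V m 0 = fun w => \sum_(j < m.+1) Y j w by apply/funext.
  have V1 : V m m.+1 = Y m.+1 by apply/funext => w; rewrite /V/= ltnn.
  have V0' : V m.+1 0 = fun w => V m 0 w + V m m.+1 w.
    by apply/funext => w; rewrite V0 V1 /V/= big_ord_recr.
  have V1' : V m.+1 m.+1 = fun=> 0 by apply/funext => w; rewrite /V/= leqnn.
  apply: (@independent_family_update2 _ _ _ P _ (V m) (V m.+1) 0 m.+1
    (fun x => x.1 + x.2) (fun=> 0) mn) => //.
  - exact: measurable_funD.
  - case=> [|i]// _ im; apply/funext => w; rewrite /V/= ltnS.
    by rewrite leq_eqVlt eqSS in im *; rewrite (negbTE im).
  - by rewrite V0' V1'; apply: independent_pair_cst; apply: measurable_funD; exact: IH.1.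
have := independent_family_pair (isT : 0 != n.+1) (iV n).
have -> : V n n.+1 = Y n.+1 by apply/funext => w; rewrite /V/= ltnn.
by have -> : V n 0 = fun w => \sum_(j < n.+1) Y j w by apply/funext.
Qed.

Lemma expectation_expR_sum (Y : nat -> T -> R) (p l a : R) n :
  ber_exp_param p l -> a < l -> independent_family P Y ->
  (forall i, ber_exp_rv P p l (Y i)) ->
  (\int[P]_w (expR (a * \sum_(i < n) Y i w))%:E =
   ((p * (l / (l - a)) + (1 - p)) ^+ n)%:E)%E.
Proof.
move=> pl al iY hY; set M := _ + _.
have E1 i : (\int[P]_w (expR (a * Y i w))%:E = M%:E)%E.
  exact: expectation_expR_ber_exp_rv.
case: n => [|n].
  under eq_integral do rewrite big_ord0 mulr0 expR0.
  by rewrite expr0 integral_cst// mul1e; exact: probability_setT.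
elim: n => [|n IH].
  by under eq_integral do rewrite big_ord_recl big_ord0 addr0; rewrite E1 expr1.
rewrite exprSr EFinM -IH -(E1 n.+1).
rewrite -(integral_independent_pairM (f := fun x => expR (a * x)) (g := fun x => expR (a * x)))//.
- by apply: eq_integral => w _; rewrite big_ord_recr/= mulrDr expRD.
- exact: independent_pair_sum.
- exact: measurable_expRM.
- exact: measurable_expRM.
Qed.

(** The left side is exactly 1 plus the exponent, so [1 + y <= exp y] suffices. The linear
    coefficient [p / l] is the mean. *)
Lemma mgf_ber_exp_le (p l a : R) : 0 <= p -> 0 < l -> a < l ->
  p * (l / (l - a)) + (1 - p) <= expR (a * (p / l) + p / (l * (l - a)) * a ^+ 2).
Proof.
move=> p0 l0 al; have la : 0 < l - a by rewrite subr_gt0.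
apply: le_trans (expR_ge1Dx _).
rewrite le_eqVlt; apply/orP; left; apply/eqP.
by field; rewrite !gt_eqF.
Qed.

(** A positive [a] controls the upper deviation, a negative one the lower deviation. *)
Lemma chernoff_ber_exp (Y : nat -> T -> R) (p l a c : R) n :
  ber_exp_param p l -> a < l -> independent_family P Y ->
  (forall i, ber_exp_rv P p l (Y i)) ->
  (P [set w | c <= a * (\sum_(i < n) Y i w - n%:R * (p / l))]%R <=
   (expR (n%:R * (p / (l * (l - a)) * a ^+ 2) - c))%:E)%E.
Proof.
move=> pl al iY hY; have [/andP[p0 p1] l0] := pl.
pose X w := a * (\sum_(i < n) Y i w - n%:R * (p / l)).
have mS : measurable_fun setT (fun w => \sum_(i < n) Y i w).
  by apply: measurable_sum => i; exact: iY.1.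
have mX : measurable_fun setT X.
  by apply: measurable_funM => //; exact: measurable_funB.
pose X' : {RV P >-> R} := HB.pack X (isMeasurableFun.Build _ _ _ _ _ mX).
apply: le_trans (chernoff X' c ltr01) _.
rewrite /mmt_gen_fun unlock.
have -> : (\int[P]_w ((expR \o 1 \o* X') w)%:E =
   \int[P]_w ((expR (- (a * (n%:R * (p / l)))))%:E * (expR (a * \sum_(i < n) Y i w))%:E))%E.
  by apply: eq_integral => w _; rewrite /= mulr1 -EFinM -expRD /X mulrBr addrC.
rewrite ge0_integralZl//; last first.
  by apply/measurable_EFinP; exact: (measurableT_comp (measurable_expRM a) mS).
rewrite (expectation_expR_sum n pl al iY hY) -!EFinM lee_fin mul1r.
rewrite [leRHS]expRD ler_pM2r ?expR_gt0//.
have M0 : 0 <= p * (l / (l - a)) + (1 - p).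
  by rewrite addr_ge0 ?subr_ge0// mulr_ge0// divr_ge0// ?subr_ge0 ltW.
apply: le_trans (_ : _ <= expR (- (a * (n%:R * (p / l)))) *
  expR (a * (p / l) + p / (l * (l - a)) * a ^+ 2) ^+ n) _.
  rewrite ler_pM2l ?expR_gt0// lerXn2r ?nnegrE ?expR_ge0//.
  exact: mgf_ber_exp_le.
rewrite -expRM_natl -expRD le_eqVlt; apply/orP; left; apply/eqP; congr expR.
rewrite -mulr_natl; ring.
Qed.

(** Borel-Cantelli, the bounds being summable as a geometric series. *)
Lemma ae_near_not_exp (F : nat -> set T) (b : R) : 0 < b ->
  (forall N, measurable (F N)) ->
  (forall N, (P (F N) <= (2 * expR (- (b * N%:R)))%:E)%E) ->
  {ae P, forall w, \forall N \near \oo, ~ F N w}.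
Proof.
move=> b0 mF PF.
have b1 : expR (- b) < 1 by rewrite expR_lt1 oppr_lt0.
have sumF : (\sum_(N <oo) P (F N) < +oo)%E.
  apply: (@le_lt_trans _ _ (2 / (1 - expR (- b)))%:E); last exact: ltry.
  apply: lime_le; first by apply: is_cvg_nneseries => *; exact: measure_ge0.
  near=> n; apply: (@le_trans _ _ (\sum_(0 <= k < n) (2 * expR (- b) ^+ k)%:E)%E).
    apply: lee_sum => k _; apply: le_trans (PF k) _.
    by rewrite lee_fin -expRM_natl -mulr_natl mulrN [k%:R * _]mulrC.
  rewrite sumEFin lee_fin -mulr_sumr ler_pM2l// big_mkord.
  rewrite -[leRHS]mul1r ler_pdivlMr ?subr_gt0// mulrC.
  by rewrite -opprB mulNr -subrX1 opprB gerBl exprn_ge0// expR_ge0.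
exists (lim_sup_set F); split.
- apply: bigcapT_measurable => k; exact: bigcup_measurable.
- exact: lim_sup_set_cvg0.
- move=> w /= Fw; rewrite /lim_sup_set => n _.
  apply: contrapT => nF; apply: Fw; exists n => // k /= nk Fk.
  by apply: nF; exists k.
Unshelve. all: by end_near. Qed.

(** The summands change with [N], as the rows of the stationary process will, so the deviation
    bounds for each [N] are summed instead of invoking a law for one sequence. *)
Lemma strong_law_array (Y : nat -> nat -> T -> R) (n : nat -> nat) (p l C e : R) :
  ber_exp_param p l -> (forall N, independent_family P (Y N)) ->
  (forall N i, ber_exp_rv P p l (Y N i)) ->
  (forall N, (n N)%:R <= C * N%:R) -> 0 < C -> 0 < e ->
  {ae P, forall w, \forall N \near \oo,
    `|\sum_(i < n N) Y N i w - (n N)%:R * (p / l)| <= e * N%:R}.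
Proof.
move=> pl iY hY nC C0 e0; have [/andP[p0 p1] l0] := pl.
(* The first bound keeps [l - b >= l / 2] for [b] equal to [a] or [- a]; the second makes the
   quadratic term at most half of the gain [a * e * N]. *)
pose a := Num.min (l / 2) (e * l ^+ 2 / (4 * C)).
have a0 : 0 < a by rewrite lt_min !divr_gt0// ?mulr_gt0// exprn_gt0.
have al : a <= l / 2 by rewrite ge_min lexx.
have ae : a <= e * l ^+ 2 / (4 * C) by rewrite ge_min lexx orbT.
have expo N b : `|b| = a ->
    (n N)%:R * (p / (l * (l - b)) * b ^+ 2) - a * (e * N%:R) <= - ((a * e / 2) * N%:R).
  move=> ba; have -> : b ^+ 2 = a ^+ 2 by rewrite -ba real_normK ?num_real.
  have lb : l / 2 <= l - b.
    by rewrite lerBrDr -lerBrDl (le_trans (ler_norm b))// ba (le_trans al)//; lra.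
  have lb0 : 0 < l - b by apply: lt_le_trans lb; rewrite divr_gt0.
  have K : p / (l * (l - b)) <= 2 / l ^+ 2.
    rewrite ler_pdivrMr ?mulr_gt0// mulrA -[2 / _ * l]mulrA expr2 invfM mulfVK ?gt_eqF//.
    rewrite (le_trans p1)// mulrAC ler_pdivlMr// mul1r.
    by move: lb; rewrite ler_pdivrMr// [_ * 2]mulrC.
  have K0 : 0 <= p / (l * (l - b)) by rewrite divr_ge0// ltW// mulr_gt0.
  have a2 : 0 <= a ^+ 2 by rewrite exprn_ge0// ltW.
  have H : (n N)%:R * (p / (l * (l - b)) * a ^+ 2) <= C * N%:R * (2 / l ^+ 2 * a ^+ 2).
    by apply: ler_pM => //; [exact: mulr_ge0|exact: ler_wpM2r].
  apply: (le_trans (lerB H (lexx _))).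
  have H2 : 2 * C / l ^+ 2 * a <= e / 2.
    apply: (le_trans (ler_wpM2l _ ae)); first by rewrite divr_ge0 ?mulr_ge0 ?ltW// exprn_gt0.
    rewrite le_eqVlt; apply/orP; left; apply/eqP; field.
    by rewrite !gt_eqF.
  have Na : 0 <= N%:R * a by rewrite mulr_ge0// ltW.
  have := ler_wpM2l Na H2.
  have -> : N%:R * a * (2 * C / l ^+ 2 * a) = C * N%:R * (2 / l ^+ 2 * a ^+ 2) by ring.
  by move=> H3; apply: (le_trans (lerB H3 (lexx _))); rewrite le_eqVlt; apply/orP; left; apply/eqP; field.
have all : a < l by apply: (le_lt_trans al); rewrite ltr_pdivrMr// ltr_pMr// ltr1n.
have Nall : - a < l by apply: lt_trans l0; rewrite oppr_lt0.
pose S N w := \sum_(i < n N) Y N i w - (n N)%:R * (p / l).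
have mS N : measurable_fun setT (S N).
  apply: measurable_funB => //.
  by apply: measurable_sum => i; exact: (iY N).1.
pose E N b := [set w | a * (e * N%:R) <= b * S N w].
have mE N b : measurable (E N b).
  have -> : E N b = (fun w => b * S N w) @^-1` `[a * (e * N%:R), +oo[.
    by apply/seteqP; split=> w /=; rewrite in_itv/= andbT.
  by apply: measurable_fun_preimage => //; exact: measurable_funM.
have PE N b : b < l -> `|b| = a -> (P (E N b) <= (expR (- ((a * e / 2) * N%:R)))%:E)%E.
  move=> bl ba; apply: le_trans (chernoff_ber_exp _ _ pl bl (iY N) (hY N)) _.
  by rewrite lee_fin ler_expR; exact: expo.
have := @ae_near_not_exp (fun N => E N a `|` E N (- a)) (a * e / 2) _ _ _.
have ae2 : 0 < a * e / 2 by rewrite divr_gt0// mulr_gt0.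
move=> /(_ ae2 (fun N => measurableU _ _ (mE N a) (mE N (- a)))).
have PU N : (P (E N a `|` E N (- a)%R) <= ((2 * expR (- (a * e / 2 * N%:R)))%R%:E))%E.
  apply: le_trans (measureU2 _ _ _) _ => //.
  rewrite mulrDl mul1r EFinD; apply: leeD; apply: PE => //.
    by rewrite gtr0_norm.
  by rewrite normrN gtr0_norm.
move=> /(_ PU); apply: filterS => w; apply: filterS => N /= EN.
rewrite leNgt; apply/negP => SN; apply: EN.
rewrite /E/= mulNr -mulrN !ler_pM2l//.
by case: (lerP 0 (S N w)) => s0; move: SN; [rewrite ger0_norm//|rewrite ltr0_norm//] => /ltW; [left|right].
Qed.

End large_numbers.

(** * Merging weights outside the quadrant *)

Section merging.
Context (R : realType) (d : measure_display) (T : measurableType d)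
  (P : probability T R) (q : R) (S : int * int -> T -> R).
Context (iS : independent_family P S)
  (hS : forall p, ber_exp_rv P q 1 (S p)).

(* The first nonzero one of the weights at [(-1, j)], ..., [(-1 - n, j)]. *)
Fixpoint merged n j : T -> R :=
  if n is n'.+1 then
    fun w => if 0 < merged n' j w then merged n' j w
             else S (Negz n'.+1, Posz j) w
  else S (Negz 0, Posz j).

(** The family after [n] merges in every row and one more in the rows [j < m]. The site [(-1, j)]
    holds the merged weight, absorbed sites hold 0. *)
Definition merging n m (p : int * int) : T -> R :=
  match p with
  | (Negz 0, Posz j) => if (j < m)%N then merged n.+1 j else merged n j
  | (Negz i.+1, Posz j) =>
      if (i < n)%N || ((i == n) && (j < m)%N) then fun=> 0 else S p
  | _ => S p
  end.

(** The parameter is the probability that at least one of [n.+1] weights is positive. *)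
Definition merging_spec n m := independent_family P (merging n m) /\
  forall j, ber_exp_rv P (1 - (1 - q) ^+ n.+1) 1 (merged n j).

Lemma merging_step n m : merging_spec n m -> merging_spec n m.+1.
Proof.
move=> [iM hM]; split=> //.
pose a : int * int := (Negz 0, Posz m); pose b : int * int := (Negz n.+1, Posz m).
have ab : a != b by [].
have Ma : merging n m a = merged n m by rewrite /= ltnn.
have Mb : merging n m b = S b by rewrite /= ltnn eqxx ltnn.
have Ma' : merging n m.+1 a = merged n.+1 m by rewrite /= ltnSn.
have Mb' : merging n m.+1 b = fun=> 0 by rewrite /= ltnn eqxx ltnSn.
have mif : measurable_fun setT (fun x : R * R => if 0 < x.1 then x.1 else x.2).
  apply: measurable_fun_ifT => //; exact: measurable_fun_ltr.
apply: (@independent_family_update2 _ _ _ P _ (merging n m) (merging n m.+1) a b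
  (fun x => if 0 < x.1 then x.1 else x.2) (fun=> 0) ab) => //.
- by rewrite Ma Mb Ma'.
- move=> [[i|[|i]] [j|j]]//=; rewrite /a /b !xpair_eqE/=.
    by move=> /negbTE jm _; rewrite ltnS (leq_eqVlt j m) (jm : (j == m) = false).
  move=> _; rewrite negb_and => /orP[/negbTE im|/negbTE jm].
    by rewrite (im : (i == n) = false).
  by rewrite ltnS (leq_eqVlt j m) (jm : (j == m) = false).
- rewrite Ma' Mb'; apply: independent_pair_cst.
  have [] := hM m; move=> mM _ _ /=; apply: measurable_fun_ifT => //.
  + exact: measurable_fun_ltr.
  + exact: iS.1.
Qed.

Lemma mergingP n : merging_spec n 0.
Proof.
elim: n => [|n IH].
  split; last by move=> j; rewrite expr1 subKr; exact: hS.
  apply: independent_family_eq iS => -[[i|[|i]] [j|j]] //=.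
  by rewrite ltn0 andbF.
have IHm m : merging_spec n m by elim: m => // m; exact: merging_step.
split.
  apply: (@independent_family_lim _ _ _ P _ (merging n)).
    by move=> m; have [] := IHm m.
  move=> [[i|[|i]] [j|j]]; exists j.+1 => m jm //=; first by rewrite jm.
  by rewrite jm andbT ltn0 andbF orbF ltnS (leq_eqVlt i n) orbC.
move=> j; have [iM hM] := IHm 0.
have ab : ((Negz 0, Posz j) : int * int) != (Negz n.+1, Posz j) by [].
have := independent_family_pair ab iM.
rewrite /= ltnn andbF /= => /ber_exp_rv_merge /(_ (hM j) (hS _)).
congr (ber_exp_rv P _ _ _). rewrite [in RHS]exprS; set u := _ ^+ _; ring.
Qed.

End merging.

(** * Construction of stationary boundary data, and their limits *)

Section stationary_construction.
Context (R : realType) (d : measure_display) (T : measurableType d)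
  (P : probability T R) (q : R) (S : int * int -> T -> R).

(* The boundary variables are functions of the weights at sites outside the
   quadrant, which the passage times do not use. *)
Lemma exists_stationary_data (g : R) : 0 < q < 1 -> 0 < g ->
  independent_family P S -> (forall p, ber_exp_rv P q 1 (S p)) ->
  exists2 B, stationary_data P q g B &
    forall i j, B (i.+1, j.+1) = S (Posz i, Posz j).
Proof.
move=> q01 g0 iS hS; have /andP[q0 q1] := q01.
have g1 : 0 < 1 + g by rewrite addr_gt0.
have gq0 : 0 <= (1 - q) * g by rewrite mulr_ge0 ?subr_ge0 ?ltW.
have gq1 : 0 < 1 + (1 - q) * g by apply: ltr_wpDr.
(* Shifting can only lower a parameter, so enough weights are merged for the parameter [pn] to be at
   least [(1 + g)^-1]. *)
have [n nE] : exists n, (1 - q) ^+ n.+1 <= 1 - (1 + g)^-1.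
  have r0 : 0 < 1 - (1 + g)^-1 by rewrite subr_gt0 invf_lt1// ltrDl.
  have /cvgrPdist_lt /(_ _ r0) [n _ nP] : (GRing.exp (1 - q) : nat -> R) @ \oo --> (0 : R).
    by apply: cvg_expr; rewrite gtr0_norm ?subr_gt0// ltrBlDr ltrDl.
  exists n; have := nP n.+1 (leqnSn n).
  rewrite sub0r normrN => /ltW; apply: le_trans.
  exact: ler_norm.
pose pn := 1 - (1 - q) ^+ n.+1.
have pn0 : (1 + g)^-1 <= pn by rewrite /pn lerBrDr -lerBrDl.
have pn1 : 0 < pn by apply: lt_le_trans pn0; rewrite invr_gt0.
(* The factor [expR (- cW)] brings [q] down to [q / (1 + (1 - q) * g)], and [expR (- cA)] brings
   [pn] down to [(1 + g)^-1]. *)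
pose cW := ln (1 + (1 - q) * g); pose cA := ln (pn * (1 + g)).
have cW0 : 0 <= cW by rewrite ln_ge0// lerDl.
have cA0 : 0 <= cA by rewrite ln_ge0// -ler_pdivrMr// div1r.
have [iM hM] := mergingP iS hS n.
(* Index 0 goes to coordinate -1 and [i.+1] to [i]: the horizontal axis reads single weights at
   height -1, the vertical one the merged weights. *)
pose psi i : int := if i is i'.+1 then Posz i' else Negz 0.
pose phi (z : int) : nat := if z is Posz i then i.+1 else 0.
have psiK : cancel (fun p : nat * nat => (psi p.1, psi p.2)) (fun p => (phi p.1, phi p.2)).
  by case=> -[|i] [|j].
have iM' := independent_family_can psiK iM.
pose f (p : nat * nat) (x : R) := match p with
  | (i.+1, 0) => Num.max (x - cW) 0 / (1 + g)
  | (0, j.+1) => Num.max (x - cA) 0 / g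
  | _ => x end.
have mf p : measurable_fun setT (f p).
  by rewrite /f; case: p => -[|i] [|j] //=; apply: measurable_funM => //;
    apply: measurable_maxr => //; exact: measurable_funB.
have iB := independent_family_comp mf iM'.
eexists; first split; first exact: iB.
- move=> i; have := ber_exp_rv_scale g1 cW0 (hS (Posz i, Negz 0)).
  by rewrite expRN lnK ?posrE.
- move=> j; have := ber_exp_rv_scale g0 cA0 (hM j).
  rewrite expRN lnK ?posrE ?mulr_gt0// invfM mulrA mulfV ?gt_eqF// mul1r.
  by [].
- by move=> i j; exact: hS.
- by [].
Qed.

Lemma quadrant_row s (W A : nat -> R) k l :
  quadrant s W A k l = - \sum_(j < l) A j + \sum_(i < k) hincr s W A i l.
Proof.
elim: k => [|k IH]; first by rewrite big_ord0 addr0.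
by rewrite big_ord_recr/= addrA -IH /hincr addrC subrK.
Qed.

(** Large [k] satisfy the bound directly; the finitely many others contribute a constant, negligible
    against [e * N]. Uniformity in [k] serves for the exit points, which depend on [N]. *)
Lemma uniform_of_average (u : nat -> R) (m : R) :
  (forall e : R, 0 < e -> \forall N \near \oo, `|u N - N%:R * m| <= e * N%:R) ->
  forall C e : R, 0 < C -> 0 < e -> \forall N \near \oo,
  forall k, k%:R <= C * N%:R -> `|u k - k%:R * m| <= e * N%:R.
Proof.
move=> h C e C0 e0; have [K _ KP] := h _ (divr_gt0 e0 C0).
pose b := \sum_(k < K) `|u k - k%:R * m|.
have b0 : 0 <= b by apply: sumr_ge0.
exists (Num.bound (b / e)) => //= N NB k kC.
have [kK|kK] := ltnP k K.
  have : b <= e * N%:R.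
    rewrite -ler_pdivrMl// mulrC ltW//; apply: lt_le_trans (archi_boundP _) _.
      by rewrite divr_ge0// ltW.
    by rewrite ler_nat.
  apply: le_trans; rewrite /b (bigD1 (Ordinal kK))//= lerDl; exact: sumr_ge0.
apply: le_trans (KP _ kK) _.
by rewrite mulrAC ler_pdivrMr// mulrAC -mulrA ler_pM2l.
Qed.

(** The values [1 / (n + 1)] of [e] suffice, and they are countably many. *)
Lemma ae_forall_eps (f : nat -> T -> R) :
  (forall e : R, 0 < e ->
    {ae P, forall w, \forall N \near \oo, f N w <= e * N%:R}) ->
  {ae P, forall w, forall e : R, 0 < e -> \forall N \near \oo, f N w <= e * N%:R}.
Proof.
move=> h.
have : {ae P, forall w, forall n, \forall N \near \oo, f N w <= n.+1%:R^-1 * N%:R}.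
  by apply/ae_foralln => n; exact: h.
apply: filterS => w hw e e0; near \oo => n.
apply: filterS (hw n) => N /le_trans; apply; rewrite ler_wpM2r//.
near: n; exists (Num.bound e^-1) => // n /= ne.
rewrite -[leRHS]invrK lef_pV2 ?posrE ?invr_gt0//.
apply: ltW; apply: lt_le_trans (archi_boundP _) _; first by rewrite invr_ge0 ltW.
by rewrite ler_nat (leq_trans ne).
Unshelve. all: by end_near. Qed.

(* [p * l^-1] for the two boundary laws [Ber(p)Exp(l)]. *)
Definition hmean (g : R) := q / (1 + (1 - q) * g) / (1 + g).
Definition vmean (g : R) := (1 + g)^-1 / g.

(** A path from abscissa 0 to [floor(x N)] has one more vertex than that, whence the successor. *)
Definition column (x : R) (N : nat) := `|Num.floor (x * N%:R)|%N.+1.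

Lemma column_bounds x N : 0 <= x -> x * N%:R <= (column x N)%:R <= x * N%:R + 1.
Proof.
move=> x0; rewrite /column.
have xN : 0 <= x * N%:R by rewrite mulr_ge0.
have fl0 : 0 <= Num.floor (x * N%:R) by rewrite floor_ge0.
have E : (`|Num.floor (x * N%:R)|%N)%:R = (Num.floor (x * N%:R))%:~R :> R.
  by rewrite -[in RHS](gez0_abs fl0).
rewrite -natr1 E lerD2r ge_floor// andbT.
by rewrite ltW// -intrD1 floorD1_gt.
Qed.

Lemma near_const_le (c e : R) : 0 < e -> \forall N \near \oo, c <= e * N%:R.
Proof.
move=> e0; exists (Num.bound (`|c| / e)) => // N /= NB.
apply: le_trans (ler_norm c) _; rewrite mulrC -ler_pdivrMr// ltW//.
apply: lt_le_trans (archi_boundP _) _; first by rewrite divr_ge0// ltW.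
by rewrite ler_nat.
Qed.

(** For the third limit, [(column x N, N.+1)] is reached up the vertical axis and then along row
    [N.+1], whose increments have a known product law by [stationary_row]. *)
Lemma stationary_limits (g x : R) (B : nat * nat -> T -> R) :
  0 <= q <= 1 -> 0 < g -> 0 < x -> stationary_data P q g B ->
  {ae P, forall w,
    [/\ forall e : R, 0 < e -> \forall N \near \oo,
          `|\sum_(i < N) bottom_incr B w i - N%:R * hmean g| <= e * N%:R,
        forall e : R, 0 < e -> \forall N \near \oo,
          `|\sum_(i < N) left_decr B w i - N%:R * vmean g| <= e * N%:R &
        forall e : R, 0 < e -> \forall N \near \oo,
          `|quadrant (bulk_weights B w) (bottom_incr B w) (left_decr B w) (column x N) N.+1 -
            N%:R * (x * hmean g - vmean g)| <= e * N%:R]}.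
Proof.
move=> q01 g0 x0 hB; have [iB BW BA BS] := hB; have /andP[q0 q1] := q01.
have g1 : 0 < 1 + g by rewrite addr_gt0.
have gq0 : 0 <= (1 - q) * g by rewrite mulr_ge0 ?subr_ge0// ltW.
have gq1 : 0 < 1 + (1 - q) * g by apply: ltr_wpDr.
have parW : ber_exp_param (q / (1 + (1 - q) * g)) (1 + g).
  split=> //; rewrite divr_ge0 ?(ltW gq1)//= ler_pdivrMr// mul1r (le_trans q1)//.
  by rewrite lerDl.
have parA : ber_exp_param (1 + g)^-1 g.
  by split=> //; rewrite invr_ge0 ltW//= invf_le1// lerDl ltW.
have iW : independent_family P (fun i => B (i.+1, 0)).
  exact: (@independent_family_can _ _ _ P (nat * nat)%type nat
    (fun i => (i.+1, 0)) (fun p => p.1.-1) _ _ iB).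
have iA : independent_family P (fun j => B (0, j.+1)).
  exact: (@independent_family_can _ _ _ P (nat * nat)%type nat
    (fun j => (0, j.+1)) (fun p => p.2.-1) _ _ iB).
have nN N : N%:R <= 1 * N%:R :> R by rewrite mul1r.
have LW := ae_forall_eps (fun e (e0 : 0 < e) =>
  strong_law_array parW (fun=> iW) (fun=> BW) nN ltr01 e0).
have LA := ae_forall_eps (fun e (e0 : 0 < e) =>
  strong_law_array parA (fun=> iA) (fun=> BA) nN ltr01 e0).
(* [column x 0] is 1; the value at 0 is reset so that a bound linear in [N] holds for all [N]. *)
pose K N := if N is 0 then 0 else column x N.
have KC N : (K N)%:R <= (x + 1) * N%:R.
  case: N => [|N]; first by rewrite mulr0.
  have /andP[_] := column_bounds N.+1 (ltW x0); move/le_trans; apply.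
  by rewrite mulrDl mul1r lerD2l ler1n.
pose Y N i w := hincr (bulk_weights B w) (bottom_incr B w) (left_decr B w) i N.+1.
have iY N : independent_family P (Y N) by have [] := stationary_row q01 g0 hB N.+1.
have hY N : forall i, ber_exp_rv P (q / (1 + (1 - q) * g)) (1 + g) (Y N i).
  by have [] := stationary_row q01 g0 hB N.+1.
have LY := ae_forall_eps (fun e (e0 : 0 < e) =>
  strong_law_array parW iY hY KC (addr_gt0 x0 ltr01) e0).
apply: filterS3 LW LA LY => w wW wA wY; split=> // e e0.
have e4 : 0 < e / 4 by rewrite divr_gt0.
have two0 : 0 < 2 :> R by [].
have UA := uniform_of_average wA two0 e4.
near=> N; rewrite quadrant_row.
have N0 : (0 < N)%N by near: N; exists 1.
have h1 : `|\sum_(j < N.+1) left_decr B w j - N.+1%:R * vmean g| <= e / 4 * N%:R.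
  suff: forall k, k%:R <= 2 * N%:R :> R ->
      `|\sum_(j < k) left_decr B w j - k%:R * vmean g| <= e / 4 * N%:R.
    by apply; rewrite mulr_natl mulr2n -natr1 lerD2l ler1n.
  by near: N; exact: UA.
have h2 : `|\sum_(i < column x N) Y N i w - (column x N)%:R * hmean g| <= e / 4 * N%:R.
  have <- : K N = column x N by rewrite /K; case: (N) N0.
  by near: N; exact: wY.
have h3 : `|hmean g| + `|vmean g| <= e / 4 * N%:R by near: N; exact: near_const_le.
have h4 : `|(column x N)%:R - x * N%:R| <= 1.
  have /andP[c1 c2] := column_bounds N (ltW x0).
  by rewrite ger0_norm ?subr_ge0// lerBlDl.
set a := \sum_(j < _) _ in h1 *; set b := \sum_(i < _) _ in h2 *.
(* The errors come from the vertical axis, the row, the rounding of [x N], and the extra row in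
   [N.+1]. *)
have -> : - a + b - N%:R * (x * hmean g - vmean g) =
  - (a - N.+1%:R * vmean g) + (b - (column x N)%:R * hmean g) +
  ((column x N)%:R - x * N%:R) * hmean g - vmean g.
  by rewrite -natr1; ring.
apply: le_trans (ler_normB _ _) _.
have h5 : `|((column x N)%:R - x * N%:R) * hmean g| <= `|hmean g|.
  by rewrite normrM ler_piMl.
have h6 := ler_normD (- (a - N.+1%:R * vmean g) + (b - (column x N)%:R * hmean g))
   (((column x N)%:R - x * N%:R) * hmean g).
have h7 := ler_normD (- (a - N.+1%:R * vmean g)) (b - (column x N)%:R * hmean g).
rewrite normrN in h7.
have eN : 0 <= e * N%:R by rewrite mulr_ge0// ltW.
lra.
Unshelve. all: by end_near. Qed.

End stationary_construction.

(** * From the given law of the weights to its description by tails *)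

Section weights.
Context (R : realType) (d : measure_display) (T : measurableType d)
  (P : probability T R).

Lemma mutually_independent_family (I : choiceType) (X : I -> {RV P >-> R}) :
  mutually_independent X -> independent_family P X.
Proof.
move=> iX; split=> [i|s A us mA]; first exact: measurable_funPT.
have := seq_fset_perm tt s; rewrite (undup_id us) => ps.
have := iX (seq_fset tt s) A mA.
by rewrite bigcap_fset (perm_big _ ps) [in RHS](perm_big _ ps).
Qed.

Lemma ber_exp_lawE (q : R) (A : set R) : 0 < q < 1 -> measurable A ->
  ber_exp_law q A =
  (q%:E * exponential_prob 1 A + (1 - q)%:E * \d_(0%R : R) A)%E.
Proof.
move=> /andP[q0 q1] mA; have q01 : 0 <= q <= 1 by rewrite !ltW.
have exp_ge0 C : (0 <= exponential_prob (1 : R) C)%E.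
  by apply: integral_ge0 => y _; rewrite lee_fin exponential_pdf_ge0.
rewrite /ber_exp_law /product_measure1 (integral_bernoulli_prob q01) /=; last first.
  by move=> b; exact: exp_ge0.
set C := xsection _ true; set D := xsection _ false.
have -> : C = A.
  by apply/seteqP; split=> y; rewrite /C /xsection /= inE /= mul1r.
have [A0|A0] := pselect (A 0).
  have -> : D = setT.
    by apply/seteqP; split=> y //; rewrite /D /xsection /= inE /= mul0r.
  rewrite diracE mem_set// [X in (_ + _ * X)%E]/exponential_prob.
  by rewrite integral_exponential_pdf.
have -> : D = set0.
  by apply/seteqP; split=> y //; rewrite /D /xsection /= inE /= mul0r.
by rewrite diracE memNset// [X in (_ + _ * X)%E]/exponential_prob integral_set0.
Qed.

(** The law makes [X] nonnegative only almost surely while [ber_exp_rv] asks for it everywhere,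
    hence the truncation at 0. *)
Lemma ber_exp_rv_max0 (q : R) (X : {RV P >-> R}) : 0 < q < 1 ->
  has_ber_exp_law q X -> ber_exp_rv P q 1 (fun w => Num.max (X w) 0).
Proof.
move=> q01 hX; split=> [|w|t t0].
- by apply: measurable_maxr => //; exact: measurable_funPT.
- by rewrite le_max lexx orbT.
- have <- : distribution P X `]t, +oo[%classic = P [set w | t < Num.max (X w) 0].
    congr (P _); apply/seteqP; split=> w /=; rewrite in_itv/= andbT lt_max.
      by move=> ->.
    by rewrite [t < 0]ltNge t0 orbF.
  rewrite hX// ber_exp_lawE// exponential_prob_itvoy// diracE memNset/=.
    by rewrite mule0 adde0.
  by rewrite in_itv/= andbT; apply/negP; rewrite -leNgt.
Qed.

Lemma ae_ge0_ber_exp_law (q : R) (X : {RV P >-> R}) : 0 < q < 1 ->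
  has_ber_exp_law q X -> {ae P, forall w, 0 <= X w}.
Proof.
move=> q01 hX; exists (X @^-1` `]-oo, 0[%classic); split.
- exact: measurable_fun_preimage.
- have -> : P (X @^-1` `]-oo, 0[%classic) = distribution P X `]-oo, 0[%classic by [].
  rewrite hX// ber_exp_lawE// diracE memNset/=; last by rewrite in_itv/= ltxx.
  rewrite mule0 adde0 /exponential_prob integral0_eq ?mule0// => x /=.
  by rewrite in_itv/= => x0; rewrite lt0_exponential_pdf.
- by move=> w /= /negP; rewrite -ltNge in_itv.
Qed.

End weights.

(** * Exit points, the free process, and directed paths *)

Section deterministic.
Context (R : realType).
Implicit Types (s : nat -> nat -> R) (W A : nat -> R).

(* The optimal path from the boundary to [(k, l)] leaves it at [(m, j)]; any
   other boundary data can only lower the cost of the same path. *)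
Lemma quadrant_exit s W A k l : exists m j,
  [/\ (m <= k)%N, (j <= l)%N, m = 0 \/ j = 0 &
      forall W' A', quadrant s W' A' k l - quadrant s W' A' m j <=
                    quadrant s W A k l - quadrant s W A m j].
Proof.
elim: k l => [|k IHk] l.
  by exists 0, l; split=> //; [left|move=> *; rewrite !subrr].
elim: l => [|l [m [j [mk jl mj eP]]]].
  by exists k.+1, 0; split=> //; [right|move=> *; rewrite !subrr].
have [m' [j' [mk' jl' mj' eP']]] := IHk l.+1.
have [le|lt] := leP (quadrant s W A k.+1 l) (quadrant s W A k l.+1 + s k l).
  exists m, j; split=> //; first exact: leqW.
  move=> W' A'; rewrite !quadrantSS (min_idPl le); apply: le_trans (eP W' A').
  by rewrite lerD2r ge_min lexx.
exists m', j'; split=> //; first exact: leqW.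
move=> W' A'; rewrite !quadrantSS (min_idPr (ltW lt)).
have := eP' W' A'; rewrite -(lerD2r (s k l)) => h.
rewrite [leRHS]addrAC; apply: le_trans h; rewrite addrAC lerD2r.
by rewrite ge_min lexx orbT.
Qed.

(** The boundary data of the passage times: the starting height is free, and row 0 is a copy of row
    1, so the horizontal axis gives no advantage. Row [l.+1] stands for height [l]. *)
Definition free_quadrant s := quadrant s (fun i => s i 0) (fun=> 0).

Lemma free_quadrant0l s l : free_quadrant s 0 l = 0.
Proof. by rewrite /free_quadrant quadrant0l big1 ?oppr0. Qed.

Lemma free_quadrant_le s k l : free_quadrant s k l.+1 <= free_quadrant s k l.
Proof.
case: k => [|k]; first by rewrite !free_quadrant0l.
by rewrite /free_quadrant quadrantSS ge_min lexx.
Qed.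

Lemma free_quadrantS1 s k : free_quadrant s k.+1 1 = free_quadrant s k 1 + s k 0.
Proof.
rewrite /free_quadrant quadrantSS; apply/min_idPr.
rewrite [leRHS]quadrantk0 big_ord_recr/= lerD2r.
by have := free_quadrant_le s k 0; rewrite [X in _ <= X -> _]quadrantk0.
Qed.

Lemma free_quadrant_homo s k l : (forall i j, 0 <= s i j) ->
  free_quadrant s k l <= free_quadrant s k.+1 l.
Proof.
move=> s0; elim: l => [|l IH].
  by rewrite /free_quadrant !quadrantk0 big_ord_recr lerDl.
rewrite [leRHS]quadrantSS le_min lerDl s0 andbT.
exact: le_trans (free_quadrant_le s k l) IH.
Qed.

Lemma le_free_quadrant s k k' l : (forall i j, 0 <= s i j) -> (k <= k')%N ->
  free_quadrant s k l <= free_quadrant s k' l.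
Proof.
move=> s0; elim: k' => [|k' IH]; first by rewrite leqn0 => /eqP ->.
rewrite leq_eqVlt => /predU1P[->//|]; rewrite ltnS => /IH /le_trans; apply.
exact: free_quadrant_homo.
Qed.

(** The inequality [G <= F]. On the vertical axis it is the sign of [A]. In row 1 the free process
    just adds weights, one of the options in the minimum for [G]; higher rows follow by the
    recursion. *)
Lemma quadrant_le_free s W A k l : (forall j, 0 <= A j) ->
  quadrant s W A k l.+1 <= free_quadrant s k l.+1.
Proof.
move=> A0; elim: k l => [|k IHk] l.
  by rewrite quadrant0l free_quadrant0l oppr_le0 sumr_ge0.
elim: l => [|l IHl].
  by rewrite free_quadrantS1 quadrantSS ge_min lerD2r IHk orbT.
rewrite [leRHS]quadrantSS le_min; apply/andP; split.
  by apply: le_trans IHl; rewrite quadrantSS ge_min lexx.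
by rewrite quadrantSS ge_min; apply/orP; right; rewrite lerD2r; exact: IHk.
Qed.

(** Paths through the first [k] columns. Counting columns admits the empty path, and [pairwise]
    makes it easy to remove the last vertex. *)
Definition staircase (k l : nat) (g : seq (int * int)) :=
  [/\ unzip1 g = [seq Posz i | i <- iota 0 k],
      pairwise <=%R (unzip2 g) & all (fun r : int => 0 <= r <= l%:Z) (unzip2 g)].

Lemma staircase_rcons k l g r : (r <= l)%N -> staircase k r g ->
  staircase k.+1 l (rcons g (Posz k, Posz r)).
Proof.
move=> rl [g1 g2 g3]; split.
- by rewrite /unzip1 map_rcons -/(unzip1 g) g1 -addn1 iotaD map_cat cats1.
- rewrite /unzip2 map_rcons pairwise_rcons g2 andbT.
  by apply: sub_all g3 => y /andP[].
- rewrite /unzip2 map_rcons all_rcons /= lez_nat rl/=.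
  by apply: sub_all g3 => y /andP[-> yr]; rewrite (le_trans yr)// lez_nat.
Qed.

Lemma staircase_rconsP k l g : staircase k.+1 l g ->
  exists g' r, [/\ g = rcons g' (Posz k, Posz r), (r <= l)%N & staircase k r g'].
Proof.
case/lastP: g => [[]//|g [i r]] [].
rewrite /unzip1 /unzip2 !map_rcons -addn1 iotaD map_cat cats1 add0n/=.
move=> /rcons_inj[g1 ->]; rewrite pairwise_rcons all_rcons/=.
case: r => // r /andP[gr g2] /andP[/andP[_ rl] g3].
exists g, r; split=> //; split=> //.
by apply/allP => y yg; rewrite (allP gr _ yg) andbT; have /andP[] := allP g3 _ yg.
Qed.

(** Induction on the last vertex [(k, r)]: lowering the height from [l] to [r] can only increase the
    free process, and then the weight of that vertex is paid. *)
Lemma free_quadrant_le_staircase (s : int * int -> R) k l g : staircase k l g ->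
  free_quadrant (fun i j => s (Posz i, Posz j)) k l.+1 <= \sum_(p <- g) s p.
Proof.
set s' := fun i j : nat => _.
elim: k l g => [|k IH] l g; first by case: g => [|? ?] [] // _ _ _; rewrite free_quadrant0l big_nil.
move=> /staircase_rconsP[g' [r [-> rl g'r]]].
rewrite -cats1 big_cat big_seq1/=.
apply: le_trans (_ : _ <= free_quadrant s' k.+1 r.+1) _.
  elim: l rl => [|l IHl]; first by rewrite leqn0 => /eqP ->.
  rewrite leq_eqVlt => /predU1P[->//|]; rewrite ltnS => /IHl; apply: le_trans.
  exact: free_quadrant_le.
rewrite [leLHS]quadrantSS; apply: le_trans (_ : _ <= free_quadrant s' k r.+1 + s' k r) _.
  by rewrite ge_min lexx orbT.
by rewrite lerD2r IH.
Qed.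

Lemma free_quadrant_staircase (s : int * int -> R) k l : exists2 g, staircase k l g &
  \sum_(p <- g) s p = free_quadrant (fun i j => s (Posz i, Posz j)) k l.+1.
Proof.
set s' := fun i j : nat => _.
elim: k l => [|k IH] l; first by exists [::] => //; rewrite free_quadrant0l big_nil.
have last_step r : (r <= l)%N -> exists2 g, staircase k.+1 l g &
    \sum_(p <- g) s p = free_quadrant s' k r.+1 + s' k r.
  move=> rl; have [g gS gE] := IH r.
  exists (rcons g (Posz k, Posz r)); first exact: staircase_rcons.
  by rewrite -cats1 big_cat big_seq1/= gE.
(* In the last column one descends while the minimum is the value just below; [r] is the height at
   which a weight is paid. *)
suff [r rl ->] : exists2 r, (r <= l)%N &
    free_quadrant s' k.+1 l.+1 = free_quadrant s' k r.+1 + s' k r.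
  exact: last_step.
elim: (l) => [|m [r rm rE]]; first by exists 0%N; rewrite // free_quadrantS1.
rewrite [free_quadrant s' _ m.+2]quadrantSS.
case: leP => _; first by exists r; rewrite // leqW.
by exists m.+1.
Qed.

Lemma passage_time_quadrant (s : int * int -> R) (k l : nat) :
  passage_time s (0, 0) (Posz k, Posz l) =
  free_quadrant (fun i j => s (Posz i, Posz j)) k.+1 l.+1.
Proof.
have E g : directed_paths (0, 0) (Posz k, Posz l) g <-> staircase k.+1 l g.
  have c : [seq (0 : int) + n%:Z | n <- iota 0 (`|Posz k - 0|%N).+1] =
      [seq Posz i | i <- iota 0 k.+1].
    by rewrite subr0; apply: eq_map => i; rewrite add0r.
  have sE t : sorted <=%R t = pairwise <=%R t :> bool.
    by rewrite sorted_pairwise//; exact: le_trans.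
  by split=> -[g1 g2 g3]; split; rewrite ?c// -?c// -?sE// sE.
have [[g gP ->] gmin] := @passage_timeP R s (0, 0) (Posz k, Posz l) isT.
apply/eqP; rewrite eq_le; apply/andP; split; last first.
  by apply: free_quadrant_le_staircase; apply/E.
have [g' /E g'P <-] := free_quadrant_staircase s k.+1 l.
by move: (gmin _ g'P); case: (passage_timeP s (isT : (0, 0).2 <= (Posz k, Posz l).2)).
Qed.

End deterministic.

(** * Deterministic bounds at a fixed outcome *)

Section limits.
Context (R : realType).
Implicit Types (s : nat -> nat -> R) (W A : nat -> R) (x a b : R).

Definition average_limit (u : nat -> R) (m : R) :=
  forall e : R, 0 < e -> \forall N \near \oo, `|u N - N%:R * m| <= e * N%:R.

(** What is retained of a stationary process at one outcome; [a] is the mean horizontal increment,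
    [b] the mean vertical decrement. *)
Definition stationary_limit s x W A a b :=
  [/\ average_limit (fun N => \sum_(i < N) W i) a,
      average_limit (fun N => \sum_(j < N) A j) b &
      average_limit (fun N => quadrant s W A (column x N) N.+1) (x * a - b)].

Lemma stationary_limit_lower s x W A a b (e : R) :
  stationary_limit s x W A a b -> (forall j, 0 <= A j) -> 0 < e ->
  \forall N \near \oo,
    N%:R * (x * a - b - e) <= free_quadrant s (column x N) N.+1.
Proof.
move=> [_ _ h] A0 e0; apply: filterS (h e e0) => N.
rewrite ler_distl => /andP[hN _].
apply: le_trans (quadrant_le_free _ _ _ _ A0).
by move: hN; lra.
Qed.

(* Raising the parameter ([W1], [A1]) rules out an optimal path leaving the
   vertical axis above height [2 t N], lowering it ([W2], [A2]) one leaving the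
   horizontal axis beyond [2 t N]. *)
Lemma stationary_limit_upper s x W A W1 A1 W2 A2 a b a1 b1 a2 b2 q (t e : R) :
  0 < x -> stationary_limit s x W A a b ->
  stationary_limit s x W1 A1 a1 b1 -> stationary_limit s x W2 A2 a2 b2 ->
  average_limit (fun N => \sum_(i < N) s i 0) q ->
  0 <= a -> 0 <= b -> 0 <= q -> b < b1 -> a2 < a -> 0 < t -> 0 < e ->
  (x * a - b) - (x * a1 - b1) <= t * (b1 - b) ->
  (x * a - b) - (x * a2 - b2) <= t * (a - a2) ->
  \forall N \near \oo, free_quadrant s (column x N) N.+1 <=
    N%:R * (x * a - b + 2 * t * (b + q) + e).
Proof.
move=> x0 [LW LA LG] [LW1 LA1 LG1] [LW2 LA2 LG2] Lq a0 b0 q0 bb1 a2a t0 e0 h1 h2.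
(* The tolerance for each fluctuation: at most three must fit in [e], and four in [t * (b1 - b)] or
   in [t * (a - a2)]. *)
pose D := Num.min (e / 3) (Num.min (t * (b1 - b) / 4) (t * (a - a2) / 4)).
have D0 : 0 < D.
  by rewrite !lt_min !divr_gt0// ?mulr_gt0// subr_gt0.
have De : D <= e / 3 by rewrite ge_min lexx.
have Db : D <= t * (b1 - b) / 4 by rewrite !ge_min lexx !orbT.
have Da : D <= t * (a - a2) / 4 by rewrite !ge_min lexx !orbT.
have C0 : 0 < x + 2 by rewrite addr_gt0.
have uW := uniform_of_average LW C0 D0.
have uA := uniform_of_average LA C0 D0.
have uA1 := uniform_of_average LA1 C0 D0.
have uW2 := uniform_of_average LW2 C0 D0.
have uq := uniform_of_average Lq C0 D0.
near=> N.
have N1 : 1 <= N%:R :> R by near: N; exists 1 => // n /= n1; rewrite ler1n.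
have KN : (column x N)%:R <= (x + 2) * N%:R :> R.
  have /andP[_ h] := column_bounds N (ltW x0); apply: le_trans h _.
  by rewrite mulrDl lerD2l; lra.
have LN : N.+1%:R <= (x + 2) * N%:R :> R.
  by rewrite -natr1; have : 0 <= x * N%:R; [rewrite mulr_ge0// ltW|lra].
have eG : `|quadrant s W A (column x N) N.+1 - N%:R * (x * a - b)| <= D * N%:R.
  by near: N; exact: LG.
have eG1 : `|quadrant s W1 A1 (column x N) N.+1 - N%:R * (x * a1 - b1)| <= D * N%:R.
  by near: N; exact: LG1.
have eG2 : `|quadrant s W2 A2 (column x N) N.+1 - N%:R * (x * a2 - b2)| <= D * N%:R.
  by near: N; exact: LG2.
have [m [j [mK jN mj exitP]]] := quadrant_exit s W A (column x N) N.+1.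
have mC : m%:R <= (x + 2) * N%:R by apply: le_trans KN; rewrite ler_nat.
have jC : j%:R <= (x + 2) * N%:R by apply: le_trans LN; rewrite ler_nat.
have eFree := exitP (fun i => s i 0) (fun=> 0).
have eE1 := exitP W1 A1.
have eE2 := exitP W2 A2.
move: eG eG1 eG2; rewrite !ler_norml => /andP[_ eG] /andP[eG1 _] /andP[eG2 _].
rewrite -/(free_quadrant s) in eFree.
have tN : 0 <= t * N%:R by rewrite mulr_ge0// ltW.
have DN : D * N%:R <= e / 3 * N%:R by rewrite ler_wpM2r.
have Nx : 0 <= N%:R :> R by [].
case: mj => [m0|j0].
- rewrite m0 in eFree eE1; rewrite free_quadrant0l quadrant0l in eFree.
  rewrite !quadrant0l in eE1.
  have vA : `|\sum_(i < j) A i - j%:R * b| <= D * N%:R by move: j jC {jN eFree eE1 exitP eE2}; near: N; exact: uA.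
  have vA1 : `|\sum_(i < j) A1 i - j%:R * b1| <= D * N%:R by move: j jC {jN vA eFree eE1 exitP eE2}; near: N; exact: uA1.
  move: vA vA1; rewrite !ler_norml => /andP[vA vA'] /andP[vA1 vA1'].
  (* Following the exit path in the first comparison process bounds [j * (b1 - b)] by [N] times the
     loss in [h1] plus [4 * D * N], each at most [t * N * (b1 - b)]. *)
  have H : j%:R * (b1 - b) <= 2 * t * N%:R * (b1 - b).
    have := ler_wpM2r Nx h1; have := ler_wpM2r Nx Db.
    lra.
  have H' : j%:R <= 2 * t * N%:R by move: H; rewrite ler_pM2r// subr_gt0.
  have H2 := ler_wpM2r b0 H'.
  have H3 : 0 <= t * N%:R * q by rewrite mulr_ge0.
  lra.
- rewrite j0 in eFree eE2; rewrite {2}/free_quadrant !quadrantk0 in eFree.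
  rewrite !quadrantk0 in eE2.
  have vW : `|\sum_(i < m) W i - m%:R * a| <= D * N%:R.
    by move: m mC {mK eFree eE1 exitP eE2}; near: N; exact: uW.
  have vW2 : `|\sum_(i < m) W2 i - m%:R * a2| <= D * N%:R.
    by move: m mC {mK vW eFree eE1 exitP eE2}; near: N; exact: uW2.
  have vq : `|\sum_(i < m) s i 0 - m%:R * q| <= D * N%:R.
    by move: m mC {mK vW vW2 eFree eE1 exitP eE2}; near: N; exact: uq.
  move: vW vW2 vq; rewrite !ler_norml => /andP[vW vW'] /andP[vW2 vW2'] /andP[vq vq'].
  have H : m%:R * (a - a2) <= 2 * t * N%:R * (a - a2).
    have := ler_wpM2r Nx h2; have := ler_wpM2r Nx Da.
    lra.
  have H' : m%:R <= 2 * t * N%:R by move: H; rewrite ler_pM2r// subr_gt0.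
  have H2 := ler_wpM2r q0 H'.
  have H3 : 0 <= t * N%:R * b by rewrite mulr_ge0.
  have H4 : 0 <= m%:R * a by rewrite mulr_ge0.
  lra.
Unshelve. all: by end_near. Qed.

End limits.

(** * The variational problem in [r] *)

Section variational.
Context (R : realType) (q x : R).

(** [hspeed], [vspeed] and [speed] are the functions [a(r)], [b(r)] and [h_r(x)] of the overview. *)
Definition hspeed (r : R) := q * r ^+ 2 / (1 - q + r * q).
Definition vspeed (r : R) := r ^+ 2 / (1 - r).
Definition speed (r : R) := r ^+ 2 * (q * x / (1 - q + r * q) - 1 / (1 - r)).

Context (q01 : 0 < q < 1) (x0 : 0 < x).

Let q0 : 0 < q. Proof. by case/andP: q01. Qed.
Let q1 : 0 < 1 - q. Proof. by rewrite subr_gt0; case/andP: q01. Qed.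
Let den r : 0 <= r -> 0 < 1 - q + r * q.
Proof. by move=> r0; apply: ltr_wpDr => //; rewrite mulr_ge0// ltW. Qed.

Lemma speedE r : speed r = x * hspeed r - vspeed r.
Proof. by rewrite /speed /hspeed /vspeed; ring. Qed.

Lemma hmeanE r : 0 < r < 1 -> hmean q ((1 - r) / r) = hspeed r.
Proof.
move=> /andP[r0 r1]; rewrite /hmean /hspeed.
have h := den (ltW r0).
have h1 : 0 < r + (1 - q) * (1 - r) by apply: addr_gt0 => //; rewrite mulr_gt0// subr_gt0.
by field; rewrite !gt_eqF//=; lra.
Qed.

Lemma vmeanE r : 0 < r < 1 -> vmean ((1 - r) / r) = vspeed r.
Proof.
move=> /andP[r0 r1]; rewrite /vmean /vspeed; field.
have r1' : 0 < 1 - r by rewrite subr_gt0.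
by rewrite !gt_eqF//=; lra.
Qed.

Lemma hspeed_ge0 r : 0 <= r -> 0 <= hspeed r.
Proof.
by move=> r0; rewrite divr_ge0 ?(ltW (den r0))// mulr_ge0 ?(ltW q0)// exprn_ge0.
Qed.

Lemma vspeed_ge0 r : r < 1 -> 0 <= vspeed r.
Proof. by move=> r1; rewrite divr_ge0 ?subr_ge0 ?(ltW r1)// sqr_ge0. Qed.

(** Here and in [hspeed_incr] a linear rate is wanted, to dominate the [o(r - c)] variation of
    [speed] at its maximum. *)
Lemma vspeed_incr c r : 0 < c -> c < r -> r < 1 -> c * (r - c) <= vspeed r - vspeed c.
Proof.
move=> c0 cr r1.
have r1' : 0 < 1 - r by rewrite subr_gt0.
have c1' : 0 < 1 - c by rewrite subr_gt0 (lt_trans cr).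
rewrite /vspeed -subr_ge0.
have -> : r ^+ 2 / (1 - r) - c ^+ 2 / (1 - c) - c * (r - c) =
  (r - c) * ((r + c - r * c) - c * ((1 - r) * (1 - c))) / ((1 - r) * (1 - c)).
  by field; rewrite !gt_eqF.
apply: divr_ge0; last by rewrite mulr_ge0// ltW.
apply: mulr_ge0; first by rewrite subr_ge0 ltW.
have r0 := lt_trans c0 cr.
have h1 : (1 - r) * (1 - c) <= 1 by apply: mulr_ile1; lra.
have h2 : c * ((1 - r) * (1 - c)) <= c by rewrite ler_piMr// ltW.
have h3 : 0 <= r * (1 - c) by rewrite mulr_ge0// ltW.
lra.
Qed.

Lemma hspeed_incr r c : 0 < r -> r < c -> c < 1 ->
  q * (1 - q) * c * (c - r) <= hspeed c - hspeed r.
Proof.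
move=> r0 rc c1; have c0 := lt_trans r0 rc.
have dr := den (ltW r0); have dc := den (ltW c0).
rewrite /hspeed -subr_ge0.
set D := (1 - q + c * q) * (1 - q + r * q).
have -> : q * c ^+ 2 / (1 - q + c * q) - q * r ^+ 2 / (1 - q + r * q) -
    q * (1 - q) * c * (c - r) =
  q * (c - r) * ((1 - q) * (c + r) + c * r * q - (1 - q) * c * D) / D.
  by rewrite /D; field; rewrite !gt_eqF.
have D0 : 0 < D by rewrite mulr_gt0.
have D1 : D <= 1.
  rewrite /D; apply: mulr_ile1; rewrite ?ltW//; have := q0; have := q1; nra.
rewrite divr_ge0 ?(ltW D0)// mulr_ge0 ?mulr_ge0 ?subr_ge0 ?(ltW rc) ?(ltW q0)//.
have h1 : (1 - q) * c * D <= (1 - q) * c.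
  by rewrite ler_piMr// mulr_ge0 ?(ltW q1)// ltW.
have h2 : 0 <= c * r * q by rewrite !mulr_ge0 ?(ltW q0)// ltW.
have h3 : 0 <= (1 - q) * r by rewrite mulr_ge0 ?(ltW q1)// ltW.
lra.
Qed.

Lemma derivable_speed r : 0 <= r < 1 -> derivable speed r 1.
Proof.
move=> /andP[r0 r1].
have h1 : 1 - q + r * q != 0 by rewrite gt_eqF// den.
have h2 : 1 - r != 0 by rewrite gt_eqF// subr_gt0.
have d1 : derivable (fun y : R => (1 - q + y * q)^-1) r 1.
  by apply: derivableV; [assumption|exact: ex_derive].
have d2 : derivable (fun y : R => (1 - y)^-1) r 1.
  by apply: derivableV; [assumption|exact: ex_derive].
have d3 : derivable (fun y : R => y ^+ 2) r 1 by exact: ex_derive.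
have dc k : derivable (fun _ : R => k : R) r 1 by exact: derivable_cst.
have -> : speed = (fun y : R => y ^+ 2) *
  ((fun=> q * x) * (fun y : R => (1 - q + y * q)^-1) - (fun=> 1) * (fun y : R => (1 - y)^-1)).
  by apply/funext => y; rewrite /speed.
exact: (derivableM d3 (derivableB (derivableM (dc _) d1) (derivableM (dc _) d2))).
Qed.

Lemma speed_le0 r : q * x * (1 - r) <= 1 - q -> 0 <= r < 1 -> speed r <= 0.
Proof.
move=> h /andP[r0 r1]; rewrite /speed.
have r1' : 0 < 1 - r by rewrite subr_gt0.
apply: mulr_ge0_le0; first exact: sqr_ge0.
rewrite subr_le0 ler_pdivrMr ?den// mulrAC ler_pdivlMr// mul1r.
apply: le_trans h _; rewrite lerDl mulr_ge0// ltW//; exact: q0.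
Qed.

(** [speed] vanishes at 0, is positive somewhere in []0, r1[] and nonpositive on [[r1, 1[], so its
    maximum over [[0, r1]] is interior and global. *)
Lemma speed_maximizer : 1 - q < q * x ->
  exists c, [/\ 0 < c < 1, forall r, 0 < r < 1 -> speed r <= speed c &
    is_derive c 1 speed 0].
Proof.
move=> qx; have qx0 : 0 < q * x by rewrite mulr_gt0// q0.
(* The solution of [q * x * (1 - r) = 1 - q], the limiting case in [speed_le0]. *)
pose r1 := 1 - (1 - q) / (q * x).
have r10 : 0 < r1 by rewrite subr_gt0 ltr_pdivrMr// mul1r.
have r11 : r1 < 1 by rewrite ltrBlDr ltrDl divr_gt0// q1.
have neg r : r1 <= r -> r < 1 -> speed r <= 0.
  move=> r1r rlt; apply: speed_le0; last by rewrite rlt (le_trans (ltW r10)).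
  rewrite mulrC -ler_pdivlMr//; move: r1r; rewrite /r1; lra.
have [|c cI cmax] := @EVT_max R speed 0 r1 (ltW r10).
  apply: derivable_within_continuous => r; rewrite in_itv/= => /andP[r0 rr1].
  by apply: derivable_speed; rewrite r0 (le_lt_trans rr1).
have pos : 0 < speed c.
  (* Below the second bound [1 - q + t * q < q * x * (1 - t)], which makes the bracket in [speed t]
     positive. *)
  pose t := Num.min r1 ((q * x - (1 - q)) / (q * x + q)) / 2.
  have e0 : 0 < (q * x - (1 - q)) / (q * x + q) by rewrite divr_gt0 ?subr_gt0// addr_gt0// q0.
  have t0 : 0 < t by rewrite divr_gt0// lt_min r10 e0.
  have tr1 : t < r1.
    by rewrite ltr_pdivrMr// (le_lt_trans (_ : _ <= r1))// ?ge_min ?lexx// ltr_pMr// ltr1n.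
  have te : t < (q * x - (1 - q)) / (q * x + q).
    rewrite ltr_pdivrMr// (le_lt_trans (_ : _ <= (q * x - (1 - q)) / (q * x + q)))// ?ge_min ?lexx ?orbT//.
    by rewrite ltr_pMr// ltr1n.
  have t1 := lt_trans tr1 r11.
  apply: lt_le_trans (cmax t _); last by rewrite in_itv/= (ltW t0) ltW.
  rewrite /speed mulr_gt0 ?exprn_gt0// subr_gt0 ltr_pdivlMr ?den// ?ltW//.
  rewrite mulrAC ltr_pdivrMr ?subr_gt0// mul1r.
  move: te; rewrite ltr_pdivlMr; last by rewrite addr_gt0// q0.
  lra.
have s0 : speed 0 = 0 by rewrite /speed expr0n mul0r.
move: cI; rewrite in_itv/= => /andP[c0 cr1].
have c0' : 0 < c.
  by rewrite lt_neqAle c0 andbT; apply/eqP => c0E; move: pos; rewrite -c0E s0 ltxx.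
have cr1' : c < r1.
  rewrite lt_neqAle cr1 andbT; apply/eqP => cE; move: pos; rewrite cE.
  by rewrite ltNge neg.
have gmax r : 0 < r < 1 -> speed r <= speed c.
  move=> /andP[rp rl]; have [rr1|rr1] := leP r r1.
    by apply: cmax; rewrite in_itv/= rr1 ltW.
  by apply: le_trans (ltW pos); apply: neg => //; exact: ltW.
exists c; split; [by rewrite c0' (lt_trans cr1')|exact: gmax|].
apply: (@derive1_at_max R speed 0 1 c); first exact: ler01.
- move=> t; rewrite in_itv/= => /andP[t0 t1].
  by apply: derivable_speed; rewrite t1 ltW.
- by rewrite in_itv/= c0' (lt_trans cr1').
- by move=> t; rewrite in_itv/=; exact: gmax.
Qed.

Lemma speed_tangent (c e : R) : is_derive c 1 speed 0 -> 0 < e ->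
  exists2 d, 0 < d & forall r, `|r - c| < d -> `|speed r - speed c| <= e * `|r - c|.
Proof.
move=> [dv dE] e0.
have /cvgrPdist_le := dv.
rewrite -/(derive _ _ _) dE.
move=> /(_ _ e0); rewrite near_withinE => /nbhs_ballP[d /= d0 hd].
exists d => // r rd; have [->|rc] := eqVneq r c; first by rewrite !subrr normr0 mulr0.
have rc0 : r - c != 0 by rewrite subr_eq0.
have := hd (r - c); rewrite /ball/= sub0r normrN => /(_ rd rc0).
have -> : (r - c)%:A + c = r :> R by rewrite /GRing.scale/= mulr1 subrK.
rewrite sub0r normrN /GRing.scale/= normrM normfV mulrC ler_pdivrMr// normr_gt0//.
Qed.

End variational.

(** * Almost sure bounds for the passage times *)

Section time_constant.
Context (R : realType) (d : measure_display) (T : measurableType d)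
  (P : probability T R) (q : R) (S : int * int -> {RV P >-> R}).
Context (q01 : 0 < q < 1) (S_indep : mutually_independent S)
  (S_law : forall p : int * int, has_ber_exp_law q (S p)).

Let q0 : 0 < q. Proof. by case/andP: q01. Qed.
Let q1 : 0 < 1 - q. Proof. by rewrite subr_gt0; case/andP: q01. Qed.
Let q01' : 0 <= q <= 1.
Proof. by case/andP: q01 => /ltW -> /ltW ->. Qed.

Let S' (p : int * int) (w : T) := Num.max (S p w) 0.

Let iS' : independent_family P S'.
Proof.
apply: (@independent_family_comp _ _ _ P _ (fun p => S p : T -> R) (fun _ x => Num.max x 0)).
  by move=> _; exact: measurable_maxr.
exact: mutually_independent_family.
Qed.

Let hS' p : ber_exp_rv P q 1 (S' p).
Proof. exact: ber_exp_rv_max0. Qed.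

Definition weights (w : T) : nat -> nat -> R := fun i j => S (Posz i, Posz j) w.

Lemma ae_weights_ge0 : {ae P, forall w i j, 0 <= weights w i j}.
Proof.
apply/ae_foralln => i; apply/ae_foralln => j.
exact: (ae_ge0_ber_exp_law q01 (S_law (Posz i, Posz j))).
Qed.

Lemma ae_stationary_limit (x r : R) : 0 < x -> 0 < r < 1 ->
  {ae P, forall w, exists W A, (forall j, 0 <= A j) /\
    stationary_limit (weights w) x W A (hspeed q r) (vspeed r)}.
Proof.
move=> x0 /andP[r0 r1].
have g0 : 0 < (1 - r) / r by rewrite divr_gt0// subr_gt0.
have [B hB BS] := exists_stationary_data q01 g0 iS' hS'.
apply: filterS2 ae_weights_ge0 (stationary_limits q01' g0 x0 hB) => w w0 [L1 L2 L3].
exists (bottom_incr B w), (left_decr B w); split.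
  by move=> j; have [_ _ /(_ j) + _] := hB => -[_ + _]; exact.
have bE : bulk_weights B w = weights w.
  apply/funext => i; apply/funext => j; rewrite /bulk_weights BS /S' /weights.
  by apply/max_idPl; exact: w0.
by move: L1 L2 L3; rewrite bE hmeanE ?r0// vmeanE ?r0.
Qed.

Lemma ae_row_limit : {ae P, forall w,
  average_limit (fun N => \sum_(i < N) weights w i 0) q}.
Proof.
have par : ber_exp_param q 1 by split.
have iY : independent_family P (fun i => S' (Posz i, Posz 0)).
  exact: (@independent_family_can _ _ _ P (int * int)%type nat
    (fun i => (Posz i, Posz 0)) (fun p => `|p.1|%N) _ _ iS').
have nN N : N%:R <= 1 * N%:R :> R by rewrite mul1r.
have L := ae_forall_eps (fun e (e0 : 0 < e) => strong_law_array par (fun=> iY)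
  (fun=> fun i => hS' (Posz i, Posz 0)) nN ltr01 e0).
apply: filterS2 ae_weights_ge0 L => w w0 L e e0; apply: filterS (L e e0) => N.
rewrite divr1; congr (`|_ - _| <= _); apply: eq_bigr => i _.
by apply/max_idPl; exact: w0.
Qed.

(** The maximizer [c] gives the main process, and [r1] above and [r2] below it give the comparison
    processes of [stationary_limit_upper]. *)
Lemma ae_upper (x e : R) : 0 < x -> 1 - q < q * x -> 0 < e ->
  {ae P, forall w, \forall N \near \oo,
    free_quadrant (weights w) (column x N) N.+1 <=
    N%:R * (sup [set speed q x r | r in `]0, 1[%classic] + e)}.
Proof.
move=> x0 qx e0; have [c [/andP[c0 c1] cmax cder]] := speed_maximizer q01 x0 qx.
have supE : sup [set speed q x r | r in `]0, 1[%classic] = speed q x c.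
  apply/eqP; rewrite eq_le; apply/andP; split.
    apply: ge_sup; first by exists (speed q x c); exists c => //=; rewrite in_itv/= c0.
    by move=> _ [r /= + <-]; rewrite in_itv/=; exact: cmax.
  apply: ub_le_sup; last by exists c => //=; rewrite in_itv/= c0.
  by exists (speed q x c) => _ [r /= + <-]; rewrite in_itv/=; exact: cmax.
have bq0 : 0 < vspeed c + q by rewrite ltr_wpDl// vspeed_ge0.
(* Chosen so that [2 * t * (vspeed c + q)] is [e / 2]. *)
pose t := e / (4 * (vspeed c + q)).
have t0 : 0 < t by rewrite divr_gt0// mulr_gt0.
pose k := q * (1 - q) * c.
have k0 : 0 < k by rewrite !mulr_gt0// q0.
(* At most [t] times the growth rates, [c] for [vspeed] and [k] for [hspeed]. *)
pose t' := t * Num.min c k.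
have t'0 : 0 < t' by rewrite mulr_gt0// lt_min c0 k0.
have [dl dl0 tan] := speed_tangent cder t'0.
pose r1 := c + Num.min (dl / 2) ((1 - c) / 2).
pose r2 := c - Num.min (dl / 2) (c / 2).
have m1 : 0 < Num.min (dl / 2) ((1 - c) / 2) by rewrite lt_min !divr_gt0// subr_gt0.
have m2 : 0 < Num.min (dl / 2) (c / 2) by rewrite lt_min !divr_gt0.
have m1d : Num.min (dl / 2) ((1 - c) / 2) <= dl / 2 by rewrite ge_min lexx.
have m1c : Num.min (dl / 2) ((1 - c) / 2) <= (1 - c) / 2 by rewrite ge_min lexx orbT.
have m2d : Num.min (dl / 2) (c / 2) <= dl / 2 by rewrite ge_min lexx.
have m2c : Num.min (dl / 2) (c / 2) <= c / 2 by rewrite ge_min lexx orbT.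
have r1c : c < r1 by rewrite ltrDl.
have r11 : r1 < 1 by rewrite /r1; lra.
have r2c : r2 < c by rewrite ltrBlDr ltrDl.
have r20 : 0 < r2 by rewrite /r2; lra.
have V := vspeed_incr c0 r1c r11.
have H := hspeed_incr q01 r20 r2c c1.
have t'c : t' <= t * c by rewrite ler_wpM2l ?(ltW t0)// ge_min lexx.
have t'k : t' <= t * k by rewrite ler_wpM2l ?(ltW t0)// ge_min lexx orbT.
have h1 : (x * hspeed q c - vspeed c) - (x * hspeed q r1 - vspeed r1) <=
    t * (vspeed r1 - vspeed c).
  rewrite -!speedE; have := tan r1.
  rewrite gtr0_norm ?subr_gt0// => /(_ _) tn.
  have : r1 - c < dl by rewrite /r1; lra.
  move=> /tn; rewrite ler_norml => /andP[+ _] => tn'.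
  have := ler_wpM2l (ltW t0) V; have rc0 : 0 <= r1 - c by rewrite subr_ge0 ltW.
  have := ler_wpM2r rc0 t'c; lra.
have h2 : (x * hspeed q c - vspeed c) - (x * hspeed q r2 - vspeed r2) <=
    t * (hspeed q c - hspeed q r2).
  rewrite -!speedE; have := tan r2.
  rewrite ltr0_norm ?subr_lt0// opprB => /(_ _) tn.
  have : c - r2 < dl by rewrite /r2; lra.
  move=> /tn; rewrite ler_norml => /andP[+ _] => tn'.
  have := ler_wpM2l (ltW t0) H; have rc0 : 0 <= c - r2 by rewrite subr_ge0 ltW.
  rewrite -/k; have := ler_wpM2r rc0 t'k; lra.
have V' : vspeed c < vspeed r1.
  by rewrite -subr_gt0 (lt_le_trans _ V)// mulr_gt0// subr_gt0.
have H' : hspeed q r2 < hspeed q c.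
  by rewrite -subr_gt0 (lt_le_trans _ H)// mulr_gt0// subr_gt0.
have e2 : 0 < e / 2 by rewrite divr_gt0.
have C := ae_stationary_limit x0 (introT andP (conj c0 c1)).
have C1 := ae_stationary_limit x0 (introT andP (conj (lt_trans c0 r1c) r11)).
have C2 := ae_stationary_limit x0 (introT andP (conj r20 (lt_trans r2c c1))).
apply: filterS2 (filterI C C1) (filterI C2 ae_row_limit) => w.
move=> [[W [A [_ L]]] [W1 [A1 [_ L1]]]] [[W2 [A2 [_ L2]]] Lq].
have := stationary_limit_upper x0 L L1 L2 Lq (hspeed_ge0 q01 (ltW c0))
  (vspeed_ge0 c1) (ltW q0) V' H' t0 e2 h1 h2.
apply: filterS => N /le_trans; apply; rewrite ler_wpM2l// supE speedE.
rewrite -addrA lerD2l le_eqVlt; apply/orP; left; apply/eqP.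
rewrite /t; field; rewrite gt_eqF//.
Qed.

(** A single [r] whose [speed] is within [e / 2] of the supremum suffices, attained or not. *)
Lemma ae_lower (x e : R) : 0 < x -> 0 < e ->
  {ae P, forall w, \forall N \near \oo,
    N%:R * (sup [set speed q x r | r in `]0, 1[%classic] - e) <=
    free_quadrant (weights w) (column x N) N.+1}.
Proof.
move=> x0 e0.
have e2 : 0 < e / 2 by rewrite divr_gt0.
have hs := time_constant_formula_has_sup q01 x0.
have [_ [r /= + <-] rs] := sup_adherent e2 hs.
rewrite in_itv/= => r01.
apply: filterS (ae_stationary_limit x0 r01) => w [W [A [A0 L]]].
apply: filterS (stationary_limit_lower L A0 e2) => N; apply: le_trans.
rewrite ler_wpM2l// -speedE.
have : sup [set speed q x r | r in `]0, 1[%classic] - e / 2 < speed q x r := rs.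
lra.
Qed.

(** If [q * x <= 1 - q], then [x] is enlarged to some [y] just above [(1 - q) / q]: the free process
    is monotone in the column, the supremum at [y] is at most [e / 2], and the one at [x] is
    nonnegative. *)
Lemma ae_upper_any (x e : R) : 0 < x -> 0 < e ->
  {ae P, forall w, \forall N \near \oo,
    free_quadrant (weights w) (column x N) N.+1 <=
    N%:R * (sup [set speed q x r | r in `]0, 1[%classic] + e)}.
Proof.
move=> x0 e0; have [qx|qx] := ltP (1 - q) (q * x); first exact: ae_upper.
have ub r : 0 < r < 1 -> forall y, 0 <= y -> 1 - q <= q * y -> speed q y r <= q * y / (1 - q) - 1.
  move=> /andP[r0 r1] y y0 qy; rewrite /speed.
  have k0 : 0 <= q * y / (1 - q) - 1 by rewrite subr_ge0 ler_pdivlMr// mul1r.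
  have h : q * y / (1 - q + r * q) - 1 / (1 - r) <= q * y / (1 - q) - 1.
    apply: lerB.
      rewrite ler_wpM2l ?mulr_ge0 ?(ltW q0)// lef_pV2 ?posrE ?lerDl ?mulr_ge0 ?(ltW q0) ?(ltW r0)//.
      by rewrite addr_gt0// mulr_gt0.
    by rewrite ler_pdivlMr ?subr_gt0// mul1r gerBl ltW.
  apply: (le_trans (ler_wpM2l (sqr_ge0 r) h)).
  by rewrite ler_piMl// exprn_ile1// ltW.
(* Chosen so that the bound [q * y / (1 - q) - 1] of [ub] is [e / 2]. *)
pose y := (1 - q) / q * (1 + e / 2).
have y0 : 0 < y by rewrite mulr_gt0 ?divr_gt0// addr_gt0// divr_gt0.
have qyE : q * y = (1 - q) * (1 + e / 2) by rewrite /y mulrA mulrCA mulfV ?mulr1// gt_eqF.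
have qy : 1 - q < q * y by rewrite qyE ltr_pMr// ltrDl divr_gt0.
have xy : x <= y by rewrite -(ler_pM2l q0) (le_trans qx)// ltW.
have supy : sup [set speed q y r | r in `]0, 1[%classic] <= e / 2.
  apply: ge_sup; first by exists (speed q y (1 / 2)); exists (1 / 2) => //=; rewrite in_itv/=; lra.
  move=> _ [r /= + <-]; rewrite in_itv/= => r01.
  apply: le_trans (ub r r01 y (ltW y0) (ltW qy)) _.
  by rewrite qyE mulrAC mulfV ?gt_eqF// mul1r addrAC subrr add0r.
(* [speed q x r] is at least [- vspeed r], which tends to 0 with [r]. *)
have supx : 0 <= sup [set speed q x r | r in `]0, 1[%classic].
  apply/ler_addgt0Pl => t t0.
  pose r := Num.min (1 / 2) (t / 2).
  have r0 : 0 < r by rewrite lt_min !divr_gt0.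
  have r2 : r <= 1 / 2 by rewrite ge_min lexx.
  have rt : r <= t / 2 by rewrite ge_min lexx orbT.
  have r1 : r < 1 by apply: le_lt_trans r2 _; lra.
  have : speed q x r <= sup [set speed q x r | r in `]0, 1[%classic].
    apply: ub_le_sup; last by exists r => //=; rewrite in_itv/= r0.
    exact: (time_constant_formula_has_sup q01 x0).2.
  rewrite speedE => hr.
  have hs := mulr_ge0 (ltW x0) (hspeed_ge0 q01 (ltW r0)).
  suff : vspeed r <= t by lra.
  rewrite /vspeed ler_pdivrMr ?subr_gt0// expr2; nra.
have e2 : 0 < e / 2 by rewrite divr_gt0.
apply: filterS2 ae_weights_ge0 (ae_upper y0 qy e2) => w w0; apply: filterS => N hN.
apply: le_trans (_ : _ <= free_quadrant (weights w) (column y N) N.+1) _.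
  apply: le_free_quadrant => //; rewrite /column ltnS.
  have xN : 0 <= x * N%:R by rewrite mulr_ge0// ltW.
  have yN : 0 <= y * N%:R by apply: mulr_ge0 => //; exact: ltW.
  rewrite -lez_nat !gez0_abs ?floor_ge0//.
  by apply: le_floor; rewrite ler_wpM2r.
apply: le_trans hN _; rewrite ler_wpM2l//.
lra.
Qed.

End time_constant.

(** * Convergence of the normalized passage times *)

Theorem mainTheorem5 (R : realType) (d : measure_display)
    (T : measurableType d) (P : probability T R) (q : R)
    (q01 : 0 < q < 1) (S : int * int -> {RV P >-> R})
    (S_indep : mutually_independent S)
    (S_law : forall p : int * int, has_ber_exp_law q (S p))
    (x : R) (x0 : 0 < x) :
  is_time_constant S x
    (sup [set r ^+ 2 * (q * x / (1 - q + r * q) - 1 / (1 - r))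
           | r in `]0, 1[%classic]).
Proof.
set c := sup _.
have dev : {ae P, forall w, forall e : R, 0 < e -> \forall N \near \oo,
    `|free_quadrant (weights S w) (column x N) N.+1 - N%:R * c| <= e * N%:R}.
  apply: ae_forall_eps => e e0.
  apply: filterS2 (ae_lower q01 S_indep S_law x0 e0)
    (ae_upper_any q01 S_indep S_law x0 e0) => w lo up.
  apply: filterS2 lo up => N lo up.
  rewrite ler_distl; apply/andP; split.
    by apply: le_trans lo; rewrite mulrBr lerD2l lerN2 mulrC.
  by apply: le_trans up _; rewrite mulrDr lerD2l mulrC.
apply: filterS dev => w hw; apply/cvgrPdist_le => e e0.
near=> N.
have N0 : 0 < N%:R :> R by near: N; exists 1 => // n /= n1; rewrite ltr0n.
have fl0 : 0 <= Num.floor (x * N%:R) by rewrite floor_ge0 mulr_ge0// ltW.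
(* The passage time to [(floor(x N), N)] is the free process at [(column x N, N.+1)]. *)
rewrite -(gez0_abs fl0) passage_time_quadrant distrC.
have : `|free_quadrant (weights S w) (column x N) N.+1 - N%:R * c| <= e * N%:R.
  by near: N; exact: hw.
rewrite -ler_pdivrMr//; congr (_ <= _).
rewrite -[X in _ / X = _](gtr0_norm N0) -normf_div mulrBl; congr (`|_ - _|).
by rewrite mulrAC mulfV ?gt_eqF// mul1r.
Unshelve. all: by end_near. Qed.
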